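(* Let $\mathscr{D}=\langle\mathscr{B},\mathscr{C}\rangle$ be a semiorthogonal decomposition of a triangulated category. Let $\beta\colon\mathscr{B}\to\mathscr{D}$ and $\gamma\colon\mathscr{C}\to\mathscr{D}$ be the inclusion functors, and $\beta^*\colon\mathscr{D}\to\mathscr{B}$ and $\gamma^!\colon\mathscr{D}\to\mathscr{C}$ their left and right adjoints, respectively. Let $\tau$ be a t-structure on $\mathscr{D}$. (a) Assume $\tau$ is noetherian and restricts to a t-structure on $\mathscr{B}$. Then $\tau$ connectively induces a t-structure $\tau_{\mathscr{C}}^{-}$ on $\mathscr{C}$ such that: (1) There is a t-structure $\tau_{\gamma\gamma^!}^{-}$ on $\mathscr{D}$ with connective part $$\{D\in{}^{\tau}\mathscr{D}^{\le 0} : \gamma\gamma^!(D)\in{}^{\tau}\mathscr{D}^{\le 0}\},$$ which right projects to a t-structure $\gamma^!(\tau_{\gamma\gamma^!}^{-})$ on $\mathscr{C}$ that coincides with $\tau_{\mathscr{C}}^{-}$. (2) The heart of $\tau_{\mathscr{C}}^{-}$ and the subcategories of bounded objects are given by ${}^{\tau_{\mathscr{C}}^{-}}\mathscr{C}^{\heartsuit}=\gamma^!\big({}^{\tau_{\gamma\gamma^!}^{-}}\mathscr{D}^{\heartsuit}\big)$ and ${}^{\tau_{\mathscr{C}}^{-}}\mathscr{C}^{?}=\gamma^!\big({}^{\tau_{\gamma\gamma^!}^{-}}\mathscr{D}^{?}\big)$ for $?\in\{+,-,\mathrm{b}\}$. (3) $\gamma^!$ is t-exact with respect to $\tau_{\gamma\gamma^!}^{-}$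 and $\tau_{\mathscr{C}}^{-}$. (4) $\gamma$ is right t-exact with respect to $\tau_{\mathscr{C}}^{-}$ and $\tau_{\gamma\gamma^!}^{-}$. (5) If $\tau$ is bounded, then $\tau_{\gamma\gamma^!}^{-}$ and $\tau_{\mathscr{C}}^{-}$ are bounded. (b) Assume $\tau$ is artinian and restricts to a t-structure on $\mathscr{C}$. Then $\tau$ coconnectively induces a t-structure $\tau_{\mathscr{B}}^{+}$ on $\mathscr{B}$ such that: (1) There is a t-structure $\tau_{\beta\beta^*}^{+}$ on $\mathscr{D}$ with coconnective part $$\{D\in{}^{\tau}\mathscr{D}^{\ge 0} : \beta\beta^*(D)\in{}^{\tau}\mathscr{D}^{\ge 0}\},$$ which left projects to a t-structure $\beta^*(\tau_{\beta\beta^*}^{+})$ on $\mathscr{B}$ that coincides with $\tau_{\mathscr{B}}^{+}$. (2) The heart of $\tau_{\mathscr{B}}^{+}$ and the subcategories of bounded objects are given by ${}^{\tau_{\mathscr{B}}^{+}}\mathscr{B}^{\heartsuit}=\beta^*\big({}^{\tau_{\beta\beta^*}^{+}}\mathscr{D}^{\heartsuit}\big)$ and ${}^{\tau_{\mathscr{B}}^{+}}\mathscr{B}^{?}=\beta^*\big({}^{\tau_{\beta\beta^*}^{+}}\mathscr{D}^{?}\big)$ for $?\in\{+,-,\mathrm{b}\}$. (3) $\beta^*$ is t-exact with respect to $\tau_{\beta\beta^*}^{+}$ and $\tau_{\mathscr{B}}^{+}$. (4) $\beta$ is left t-exact with respect to $\tau_{\mathscr{B}}^{+}$ and $\tau_{\beta\beta^*}^{+}$.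 (5) If $\tau$ is bounded, then $\tau_{\beta\beta^*}^{+}$ and $\tau_{\mathscr{B}}^{+}$ are bounded.
   Context: Convention: in a semiorthogonal decomposition $\mathscr{D}=\langle \mathscr{B},\mathscr{C}\rangle$ one has $\mathrm{Hom}(C,B[n])=0$ for all $C\in\mathscr{C}$, $B\in\mathscr{B}$, $n\in\mathbf{Z}$, and every $D\in\mathscr{D}$ fits in a distinguished triangle $C\to D\to B$ with $C\in\mathscr{C}$, $B\in\mathscr{B}$; the adjoints $\beta^*,\gamma^!$ then exist. A t-structure $\tau=({}^{\tau}\mathscr{D}^{\le 0},{}^{\tau}\mathscr{D}^{\ge 0})$ has connective part ${}^{\tau}\mathscr{D}^{\le 0}$, coconnective part ${}^{\tau}\mathscr{D}^{\ge 0}$, ${}^{\tau}\mathscr{D}^{\le n}={}^{\tau}\mathscr{D}^{\le 0}[-n]$, ${}^{\tau}\mathscr{D}^{\ge n}={}^{\tau}\mathscr{D}^{\ge 0}[-n]$, heart ${}^{\tau}\mathscr{D}^{\heartsuit}={}^{\tau}\mathscr{D}^{\le 0}\cap{}^{\tau}\mathscr{D}^{\ge 0}$. Put ${}^{\tau}\mathscr{D}^{+}=\bigcup_n{}^{\tau}\mathscr{D}^{\ge n}$, ${}^{\tau}\mathscr{D}^{-}=\bigcup_n{}^{\tau}\mathscr{D}^{\le n}$, ${}^{\tau}\mathscr{D}^{\mathrm{b}}={}^{\tau}\mathscr{D}^{+}\cap{}^{\tau}\mathscr{D}^{-}$; $\tau$ is bounded if $\mathscr{D}={}^{\tau}\mathscr{D}^{\mathrm{b}}$.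 $\tau$ is noetherian (artinian) if its heart is a noetherian (artinian) abelian category: ascending (descending) chains of subobjects of any object stabilize. A triangulated functor is right (left) t-exact if it preserves connective (coconnective) parts, and t-exact if both. Let $\alpha\colon\mathscr{A}\to\mathscr{D}$ be the inclusion of a full triangulated subcategory. - $\tau$ restricts to a t-structure on $\mathscr{A}$ if $({}^{\tau}\mathscr{D}^{\le 0}\cap\mathscr{A},{}^{\tau}\mathscr{D}^{\ge 0}\cap\mathscr{A})$ is a t-structure on $\mathscr{A}$. - If $\alpha$ has a right adjoint $\alpha^!$ (resp. left adjoint $\alpha^*$), $\tau$ right (resp. left) projects to a t-structure on $\mathscr{A}$ if the pair of essential images $\alpha^!\tau=(\alpha^!({}^{\tau}\mathscr{D}^{\le 0}),\alpha^!({}^{\tau}\mathscr{D}^{\ge 0}))$ (resp. $\alpha^*\tau=(\alpha^*({}^{\tau}\mathscr{D}^{\le 0}),\alpha^*({}^{\tau}\mathscr{D}^{\ge 0}))$) is a t-structure on $\mathscr{A}$. - $\tau$ connectively induces a t-structure on $\mathscr{A}$ if $\tau_{\mathscr{A}}^{-}=(\mathscr{A}^{\le 0},\mathscr{A}^{\ge 0})$ with $\mathscr{A}^{\le 0}={}^{\tau}\mathscr{D}^{\le 0}\cap\mathscr{A}$ and $\mathscr{A}^{\ge 0}=\{A\in\mathscr{A}:\mathrm{Hom}(A'[1],A)=0\ \forall A'\in\mathscr{A}^{\le 0}\}$ is a t-structure on $\mathscr{A}$. - $\tau$ coconnectively induces a t-structure on $\mathscr{A}$ if $\tau_{\mathscr{A}}^{+}=(\mathscr{A}^{\le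 0},\mathscr{A}^{\ge 0})$ with $\mathscr{A}^{\ge 0}={}^{\tau}\mathscr{D}^{\ge 0}\cap\mathscr{A}$ and $\mathscr{A}^{\le 0}=\{A\in\mathscr{A}:\mathrm{Hom}(A,A'[-1])=0\ \forall A'\in\mathscr{A}^{\ge 0}\}$ is a t-structure on $\mathscr{A}$. *)

(* Defs.v *)
From mathcomp Require Import all_boot all_algebra.
From mathcomp Require Import boolp classical_sets.

Set Implicit Arguments.
Unset Strict Implicit.
Unset Printing Implicit Defensive.

Import GRing.Theory.

Declare Scope cat_scope.
Delimit Scope cat_scope with cat.

Local Open Scope classical_set_scope.
Local Open Scope ring_scope.
Local Open Scope cat_scope.

Record preadditive : Type := Preadditive {
  obj :> Type;
  hom : obj -> obj -> zmodType;
  idm : forall X : obj, hom X X;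
  mcomp : forall X Y Z : obj, hom Y Z -> hom X Y -> hom X Z;
  mcompA : forall (W X Y Z : obj) (h : hom Y Z) (g : hom X Y) (f : hom W X),
    mcomp h (mcomp g f) = mcomp (mcomp h g) f;
  mcomp1m : forall (X Y : obj) (f : hom X Y), mcomp (idm Y) f = f;
  mcompm1 : forall (X Y : obj) (f : hom X Y), mcomp f (idm X) = f;
  mcompDl : forall (X Y Z : obj) (g g' : hom Y Z) (f : hom X Y),
    mcomp (g + g') f = mcomp g f + mcomp g' f;
  mcompDr : forall (X Y Z : obj) (g : hom Y Z) (f f' : hom X Y),
    mcomp g (f + f') = mcomp g f + mcomp g f' }.

Arguments hom {_} _ _.
Arguments idm {_} _.
Arguments mcomp {_ _ _ _} _ _.

Notation "g \o f" := (mcomp g f) : cat_scope.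

Section Preadditive.
Variable C : preadditive.
Implicit Types X Y Z S : C.

Definition is_iso X Y (f : hom X Y) : Prop :=
  exists g : hom Y X, g \o f = idm X /\ f \o g = idm Y.

Definition isomorphic X Y : Prop := exists f : hom X Y, is_iso f.

Definition zero_object Z : Prop :=
  (forall X (f : hom Z X), f = 0) /\ (forall X (f : hom X Z), f = 0).

Definition is_biproduct X Y S : Prop :=
  exists (i : hom X S) (j : hom Y S) (p : hom S X) (q : hom S Y),
    [/\ p \o i = idm X, q \o j = idm Y, p \o j = 0, q \o i = 0
      & (i \o p) + (j \o q) = idm S].

Definition additive_category : Prop :=
  (exists Z, zero_object Z) /\ (forall X Y, exists S, is_biproduct X Y S).

Definition is_mono X Y (f : hom X Y) : Prop :=
  forall W (u v : hom W X), f \o u = f \o v -> u = v.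

Record subobject X : Type := Subobject {
  so_obj : C;
  so_map : hom so_obj X;
  so_mono : is_mono so_map }.

Definition so_le X (S T : subobject X) : Prop :=
  exists u : hom (so_obj S) (so_obj T), so_map T \o u = so_map S.

Definition so_eq X (S T : subobject X) : Prop := so_le S T /\ so_le T S.

Definition noetherian_category : Prop :=
  forall X (S : nat -> subobject X),
    (forall n, so_le (S n) (S n.+1)) ->
    exists N, forall n, (N <= n)%N -> so_eq (S n) (S N).

Definition artinian_category : Prop :=
  forall X (S : nat -> subobject X),
    (forall n, so_le (S n.+1) (S n)) ->
    exists N, forall n, (N <= n)%N -> so_eq (S n) (S N).

End Preadditive.

Definition full_subcat (C : preadditive) (P : set C) : preadditive :=
  @Preadditive {X : C | P X} (fun X Y => hom (sval X) (sval Y))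
    (fun X => idm (sval X)) (fun X Y Z g f => g \o f)
    (fun _ _ _ _ => @mcompA C _ _ _ _) (fun _ _ => @mcomp1m C _ _)
    (fun _ _ => @mcompm1 C _ _) (fun _ _ _ => @mcompDl C _ _ _)
    (fun _ _ _ => @mcompDr C _ _ _).

Record functor (C D : preadditive) : Type := Functor {
  fobj :> C -> D;
  fmap : forall X Y : C, hom X Y -> hom (fobj X) (fobj Y);
  fmap1 : forall X : C, fmap (idm X) = idm (fobj X);
  fmapM : forall (X Y Z : C) (g : hom Y Z) (f : hom X Y),
    fmap (g \o f) = fmap g \o fmap f }.

Arguments fmap {C D} _ {X Y} _.

Definition additive_functor (C D : preadditive) (F : functor C D) : Prop :=
  forall (X Y : C) (f g : hom X Y), fmap F (f + g) = fmap F f + fmap F g.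

Definition ess_image (C D : preadditive) (F : functor C D) (P : set C) : set D :=
  [set Y | exists2 X, P X & isomorphic (F X) Y].

(** [F] is left adjoint to [G]. *)
Record adjunction (C D : preadditive) (F : functor C D) (G : functor D C) :
    Type := Adjunction {
  aunit : forall X : C, hom X (G (F X));
  acounit : forall Y : D, hom (F (G Y)) Y;
  aunit_nat : forall (X X' : C) (f : hom X X'),
    aunit X' \o f = fmap G (fmap F f) \o aunit X;
  acounit_nat : forall (Y Y' : D) (g : hom Y Y'),
    g \o acounit Y = acounit Y' \o fmap F (fmap G g);
  adj_triangleF : forall X : C, acounit (F X) \o fmap F (aunit X) = idm (F X);
  adj_triangleG : forall Y : D, fmap G (acounit Y) \o aunit (G Y) = idm (G Y) }.

(** The shift is an autoequivalence, with a chosen quasi-inverse [unshift]; it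
    is not required to be a strict automorphism.  [dist f g h] means that
    X -f-> Y -g-> Z -h-> X[1] is distinguished. *)
Record triangulated : Type := Triangulated {
  tcat :> preadditive;
  tadditive : additive_category tcat;
  shift : functor tcat tcat;
  unshift : functor tcat tcat;
  shift_additive : additive_functor shift;
  shift_unshift : forall X : tcat, hom (shift (unshift X)) X;
  shift_unshift_iso : forall X : tcat, is_iso (shift_unshift X);
  shift_unshift_nat : forall (X Y : tcat) (f : hom X Y),
    f \o shift_unshift X = shift_unshift Y \o fmap shift (fmap unshift f);
  unshift_shift : forall X : tcat, hom (unshift (shift X)) X;
  unshift_shift_iso : forall X : tcat, is_iso (unshift_shift X);
  unshift_shift_nat : forall (X Y : tcat) (f : hom X Y),
    f \o unshift_shift X = unshift_shift Y \o fmap unshift (fmap shift f);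
  dist : forall X Y Z : tcat, hom X Y -> hom Y Z -> hom Z (shift X) -> Prop;
  dist_iso : forall (X Y Z X' Y' Z' : tcat)
      (f : hom X Y) (g : hom Y Z) (h : hom Z (shift X))
      (f' : hom X' Y') (g' : hom Y' Z') (h' : hom Z' (shift X'))
      (a : hom X X') (b : hom Y Y') (c : hom Z Z'),
    is_iso a -> is_iso b -> is_iso c ->
    b \o f = f' \o a -> c \o g = g' \o b -> fmap shift a \o h = h' \o c ->
    dist f g h -> dist f' g' h';
  dist_id : forall X Z : tcat, zero_object Z ->
    dist (idm X) (0 : hom X Z) (0 : hom Z (shift X));
  dist_cone : forall (X Y : tcat) (f : hom X Y),
    exists (Z : tcat) (g : hom Y Z) (h : hom Z (shift X)), dist f g h;
  dist_rotate : forall (X Y Z : tcat)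
      (f : hom X Y) (g : hom Y Z) (h : hom Z (shift X)),
    dist f g h <-> dist g h (- fmap shift f);
  dist_fill : forall (X Y Z X' Y' Z' : tcat)
      (f : hom X Y) (g : hom Y Z) (h : hom Z (shift X))
      (f' : hom X' Y') (g' : hom Y' Z') (h' : hom Z' (shift X'))
      (a : hom X X') (b : hom Y Y'),
    dist f g h -> dist f' g' h' -> b \o f = f' \o a ->
    exists c : hom Z Z', c \o g = g' \o b /\ fmap shift a \o h = h' \o c;
  dist_octahedron : forall (X Y Z Q1 Q2 Q3 : tcat)
      (f : hom X Y) (p1 : hom Y Q1) (d1 : hom Q1 (shift X))
      (g : hom Y Z) (p2 : hom Z Q2) (d2 : hom Q2 (shift X))
      (p3 : hom Z Q3) (d3 : hom Q3 (shift Y)),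
    dist f p1 d1 -> dist (g \o f) p2 d2 -> dist g p3 d3 ->
    exists (a : hom Q1 Q2) (b : hom Q2 Q3),
      [/\ dist a b (fmap shift p1 \o d3),
          a \o p1 = p2 \o g, d2 \o a = d1,
          b \o p2 = p3 & d3 \o b = fmap shift f \o d2] }.

Arguments shift {_}.
Arguments unshift {_}.
Arguments dist {_ _ _ _} _ _ _.

Definition shiftz (D : triangulated) (n : int) (X : D) : D :=
  match n with
  | Posz k => iter k shift X
  | Negz k => iter k.+1 unshift X
  end.

(** P[n], up to isomorphism *)
Definition shift_set (D : triangulated) (n : int) (P : set D) : set D :=
  [set Y | exists2 X, P X & isomorphic (shiftz n X) Y].

(** Full triangulated subcategories, taken to be closed under isomorphism. *)
Record tri_sub (D : triangulated) : Type := TriSub {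
  sub_mem :> D -> Prop;
  sub_iso : forall X Y : D, isomorphic X Y -> sub_mem X -> sub_mem Y;
  sub_zero : forall Z : D, zero_object Z -> sub_mem Z;
  sub_biproduct : forall X Y S : D,
    is_biproduct X Y S -> sub_mem X -> sub_mem Y -> sub_mem S;
  sub_shift : forall X : D, sub_mem X -> sub_mem (shift X);
  sub_unshift : forall X : D, sub_mem X -> sub_mem (unshift X);
  sub_cone : forall (X Y Z : D) (f : hom X Y) (g : hom Y Z) (h : hom Z (shift X)),
    dist f g h -> sub_mem X -> sub_mem Y -> sub_mem Z }.

Section SubTriangulated.
Variables (D : triangulated) (A : tri_sub D).

Let C : preadditive := full_subcat (sub_mem A).

Definition restr_functor (F : functor D D) (FA : forall X, A X -> A (F X)) :
    functor C C :=
  @Functor C C (fun X => exist _ (F (sval X)) (FA _ (svalP X)))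
    (fun X Y f => fmap F f) (fun X => fmap1 F (sval X))
    (fun X Y Z g f => fmapM F g f).

Lemma sub_additive : additive_category C.
Proof.
have [[Z [Z1 Z2]] biP] := tadditive D.
split.
  by exists (exist _ Z (sub_zero A (conj Z1 Z2))); split=> X f; [exact: Z1|exact: Z2].
move=> [X AX] [Y AY]; have [S biS] := biP X Y.
by exists (exist _ S (sub_biproduct biS AX AY)).
Qed.

Lemma sub_dist_id (X Z : C) : zero_object Z ->
  dist (idm (sval X)) (0 : hom (sval X) (sval Z)) 0.
Proof.
move=> [Z1 _]; have id0 : idm (sval Z) = 0 by exact: (Z1 Z).
have mul0 U V (f : hom U V) : (0 : hom V (sval Z)) \o f = 0.
  by apply: (addrI ((0 : hom V (sval Z)) \o f)); rewrite -mcompDl !addr0.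
have mulr0 U V (g : hom (sval Z) V) : g \o (0 : hom U (sval Z)) = 0.
  by apply: (addrI (g \o (0 : hom U (sval Z)))); rewrite -mcompDr !addr0.
apply: dist_id; split=> W f.
  by rewrite -[f]mcompm1 id0 mulr0.
by rewrite -[f]mcomp1m id0 mul0.
Qed.

Lemma sub_dist_cone (X Y : C) (f : hom X Y) :
  exists (Z : C) (g : hom Y Z) (h : hom (sval Z) (shift (sval X))),
    @dist D (sval X) (sval Y) (sval Z) f g h.
Proof.
have [Z [g [h fgh]]] := @dist_cone D (sval X) (sval Y) f.
by exists (exist _ Z (sub_cone fgh (svalP X) (svalP Y))), g, h.
Qed.

Definition subcat : triangulated :=
  @Triangulated C sub_additive
    (restr_functor (@sub_shift D A)) (restr_functor (@sub_unshift D A))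
    (fun X Y => @shift_additive D (sval X) (sval Y))
    (fun X => shift_unshift (sval X))
    (fun X => shift_unshift_iso (sval X))
    (fun X Y => @shift_unshift_nat D (sval X) (sval Y))
    (fun X => unshift_shift (sval X))
    (fun X => unshift_shift_iso (sval X))
    (fun X Y => @unshift_shift_nat D (sval X) (sval Y))
    (fun X Y Z f g h => @dist D (sval X) (sval Y) (sval Z) f g h)
    (fun X Y Z X' Y' Z' => @dist_iso D (sval X) (sval Y) (sval Z)
                                       (sval X') (sval Y') (sval Z'))
    sub_dist_id sub_dist_cone
    (fun X Y Z => @dist_rotate D (sval X) (sval Y) (sval Z))
    (fun X Y Z X' Y' Z' => @dist_fill D (sval X) (sval Y) (sval Z)
                                        (sval X') (sval Y') (sval Z'))
    (fun X Y Z Q1 Q2 Q3 => @dist_octahedron D (sval X) (sval Y) (sval Z)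
                                              (sval Q1) (sval Q2) (sval Q3)).

Definition incl : functor subcat D :=
  @Functor subcat D (fun X => sval X) (fun X Y f => f)
    (fun X => erefl _) (fun X Y Z g f => erefl _).

End SubTriangulated.

Definition semiorthogonal (D : triangulated) (B C : tri_sub D) : Prop :=
  (forall (X Y : D) (n : int), C X -> B Y ->
     forall f : hom X (shiftz n Y), f = 0) /\
  (forall X : D, exists (Y Z : D) (f : hom Y X) (g : hom X Z)
     (h : hom Z (shift Y)), [/\ C Y, B Z & dist f g h]).

Record tpair (D : triangulated) : Type := TPair {
  conn : set D;
  coconn : set D }.

Section TStructure.
Variable D : triangulated.
Implicit Type t : tpair D.

Definition le_part t (n : int) : set D := shift_set (- n) (conn t).
Definition ge_part t (n : int) : set D := shift_set (- n) (coconn t).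

Record is_tstructure t : Prop := IsTStructure {
  conn_iso : forall X Y : D, isomorphic X Y -> conn t X -> conn t Y;
  coconn_iso : forall X Y : D, isomorphic X Y -> coconn t X -> coconn t Y;
  conn_le1 : conn t `<=` le_part t 1;
  coconn_ge1 : ge_part t 1 `<=` coconn t;
  t_orthogonal : forall X Y : D, conn t X -> ge_part t 1 Y ->
    forall f : hom X Y, f = 0;
  t_triangle : forall X : D, exists (Y Z : D) (f : hom Y X) (g : hom X Z)
    (h : hom Z (shift Y)), [/\ conn t Y, ge_part t 1 Z & dist f g h] }.

Definition heart t : set D := conn t `&` coconn t.
Definition tplus t : set D := \bigcup_(n : int) ge_part t n.
Definition tminus t : set D := \bigcup_(n : int) le_part t n.
Definition tbdd t : set D := tplus t `&` tminus t.

Definition tbounded t : Prop := tbdd t = setT.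

(** The heart of a t-structure is always an abelian category, so only the chain
    condition is imposed. *)
Definition tnoetherian t : Prop := noetherian_category (full_subcat (heart t)).
Definition tartinian t : Prop := artinian_category (full_subcat (heart t)).

End TStructure.

Definition right_t_exact (D E : triangulated) (F : functor D E)
    (t : tpair D) (u : tpair E) : Prop :=
  forall X : D, conn t X -> conn u (F X).

Definition left_t_exact (D E : triangulated) (F : functor D E)
    (t : tpair D) (u : tpair E) : Prop :=
  forall X : D, coconn t X -> coconn u (F X).

Definition t_exact (D E : triangulated) (F : functor D E)
    (t : tpair D) (u : tpair E) : Prop :=
  right_t_exact F t u /\ left_t_exact F t u.

Definition timage (D E : triangulated) (F : functor D E) (t : tpair D) : tpair E :=
  TPair (ess_image F (conn t)) (ess_image F (coconn t)).

(** For [F] a right (left) adjoint of the inclusion of [E] in [D], this says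
    that [t] right (left) projects to a t-structure on [E]. *)
Definition t_projects (D E : triangulated) (F : functor D E) (t : tpair D) : Prop :=
  is_tstructure (timage F t).

Section Induced.
Variables (D : triangulated) (t : tpair D) (A : tri_sub D).

Definition trestr : tpair (subcat A) :=
  @TPair (subcat A) (incl A @^-1` conn t) (incl A @^-1` coconn t).

Definition t_restricts : Prop := is_tstructure trestr.

Definition tconn_induced : tpair (subcat A) :=
  @TPair (subcat A) (incl A @^-1` conn t)
    [set X | forall Y : subcat A, conn t (incl A Y) ->
               forall f : hom (shift Y) X, f = 0].

Definition connectively_induces : Prop := is_tstructure tconn_induced.

Definition tcoconn_induced : tpair (subcat A) :=
  @TPair (subcat A)
    [set X | forall Y : subcat A, coconn t (incl A Y) ->
               forall f : hom X (unshift Y), f = 0]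
    (incl A @^-1` coconn t).

Definition coconnectively_induces : Prop := is_tstructure tcoconn_induced.

End Induced.

(* Main.v *)
From mathcomp Require Import all_boot all_algebra.
From mathcomp Require Import boolp classical_sets.
Require Import Defs.

(** Part (b) is part (a) for the opposite category: the opposite of a
    triangulated category is triangulated, with the inverse shift, and passing
    to it exchanges connective and coconnective parts, [B] and [C], left and
    right adjoints, and noetherian and artinian hearts.  So [opp_tri] is built
    first and only (a) is argued; the same device gives the second half of most
    statements about triangles.

    For (a), write K -> X -> Q for the triangle of [X] with [K] in [C] and [Q] in
    [B]; then K is gamma gamma^! X.  Let [U] consist of the connective [X] whose
    [K] is connective ([tilted_conn]).  As tau restricts to [B], the part [Q] of a
    connective [X] is connective ([conn_bpart]), so [K] is an extension of [X] by
    Q[-1] and can fail to be connective only in degree 1.  Hence [U] lies between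
    the shift of the connective part and the connective part, and it is closed
    under extensions ([tilted_conn_ext]).  Such a [U] is governed by its trace on
    the heart, and noetherianity makes that trace a torsion class: any object A of
    the heart has a maximal subobject S in [U], and no nonzero morphism goes from
    [U] to A/S ([hom0_torsion_free]).  Splicing this torsion sequence with the
    truncation triangles of tau yields truncation triangles for [U]
    ([torsion_trunc]), which is the t-structure on [D] asked for.

    What remains holds for any t-structure t on [D] whose connective part is
    stable under gamma gamma^!.  If K in [C] is coconnective for the induced pair
    on [C], its truncation K -> X in degrees at least 0 for t has a fibre without
    [C]-part: that part maps to zero in K by assumption and in X by
    orthogonality.  So the fibre lies in [B] and K is the image of the
    t-coconnective X under gamma^! ([coconn_lift]).  Every assertion on images,
    hearts and boundedness follows by shifting. *)

Set Implicit Arguments.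
Unset Strict Implicit.
Unset Printing Implicit Defensive.

Import GRing.Theory.

Local Open Scope classical_set_scope.
Local Open Scope ring_scope.
Local Open Scope cat_scope.

(** * Preadditive categories *)

Section PreadditiveTheory.
Variable C : preadditive.
Implicit Types X Y Z : C.

Lemma comp0m X Y Z (f : hom X Y) : (0 : hom Y Z) \o f = 0.
Proof. by apply: (addrI ((0 : hom Y Z) \o f)); rewrite -mcompDl !addr0. Qed.

Lemma compm0 X Y Z (g : hom Y Z) : g \o (0 : hom X Y) = 0.
Proof. by apply: (addrI (g \o (0 : hom X Y))); rewrite -mcompDr !addr0. Qed.

Lemma compNm X Y Z (g : hom Y Z) (f : hom X Y) : (- g) \o f = - (g \o f).
Proof. by apply: (addrI (g \o f)); rewrite -mcompDl !subrr comp0m. Qed.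

Lemma compmN X Y Z (g : hom Y Z) (f : hom X Y) : g \o (- f) = - (g \o f).
Proof. by apply: (addrI (g \o f)); rewrite -mcompDr !subrr compm0. Qed.

Lemma compmB X Y Z (g : hom Y Z) (f f' : hom X Y) :
  g \o (f - f') = (g \o f) - (g \o f').
Proof. by rewrite mcompDr compmN. Qed.

Lemma is_iso_id X : is_iso (idm X).
Proof. by exists (idm X); rewrite mcomp1m. Qed.

Lemma is_iso_oppid X : is_iso (- idm X).
Proof. by exists (- idm X); rewrite compNm compmN mcomp1m opprK. Qed.

Lemma isomorphic_refl X : isomorphic X X.
Proof. by exists (idm X); apply: is_iso_id. Qed.

Lemma isomorphic_sym X Y : isomorphic X Y -> isomorphic Y X.
Proof. by move=> [f [g [gf fg]]]; exists g, f. Qed.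

Lemma isomorphic_trans X Y Z :
  isomorphic X Y -> isomorphic Y Z -> isomorphic X Z.
Proof.
move=> [f [f' [f'f ff']]] [g [g' [g'g gg']]]; exists (g \o f), (f' \o g').
by rewrite -!mcompA [g' \o _]mcompA g'g mcomp1m [f \o _]mcompA ff' mcomp1m.
Qed.

Lemma isomorphic_fobj (E : preadditive) (F : functor C E) X Y :
  isomorphic X Y -> isomorphic (F X) (F Y).
Proof.
move=> [f [g [gf fg]]]; exists (fmap F f), (fmap F g).
by rewrite -!fmapM gf fg !fmap1.
Qed.

Definition inv_iso X Y (f : hom X Y) (fiso : is_iso f) : hom Y X :=
  sval (cid fiso).

Lemma inv_isol X Y (f : hom X Y) (i : is_iso f) : inv_iso i \o f = idm X.
Proof. by rewrite /inv_iso; case: (cid i) => g []. Qed.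

Lemma inv_isor X Y (f : hom X Y) (i : is_iso f) : f \o inv_iso i = idm Y.
Proof. by rewrite /inv_iso; case: (cid i) => g []. Qed.

Lemma is_iso_inv X Y (f : hom X Y) (i : is_iso f) : is_iso (inv_iso i).
Proof. by exists f; rewrite inv_isol inv_isor. Qed.

Lemma zero_object_id X : idm X = 0 -> zero_object X.
Proof.
by move=> id0; split=> Y f; [rewrite -[f]mcompm1|rewrite -[f]mcomp1m];
  rewrite id0 ?compm0 ?comp0m.
Qed.

Lemma zero_object_iso X Y : zero_object X -> isomorphic X Y -> zero_object Y.
Proof.
move=> [_ X0] [f [g [_ fg]]]; apply: zero_object_id.
by rewrite -fg (X0 _ g) compm0.
Qed.

End PreadditiveTheory.

(** * Opposite categories *)

Section Opposite.

Definition opp_cat (C : preadditive) : preadditive :=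
  @Preadditive C (fun X Y => hom Y X) (@idm C) (fun X Y Z g f => f \o g)
    (fun _ _ _ _ h g f => esym (mcompA f g h))
    (fun _ _ => @mcompm1 C _ _) (fun _ _ => @mcomp1m C _ _)
    (fun _ _ _ g g' f => mcompDr f g g') (fun _ _ _ g f f' => mcompDl f f' g).

Definition opp_functor (C E : preadditive) (F : functor C E) :
    functor (opp_cat C) (opp_cat E) :=
  @Functor (opp_cat C) (opp_cat E) F (fun X Y f => fmap F f)
    (fmap1 F) (fun _ _ _ g f => fmapM F f g).

Variable C : preadditive.

Lemma opp_is_iso (X Y : C) (f : hom X Y) :
  is_iso f -> @is_iso (opp_cat C) Y X f.
Proof. by move=> [g [gf fg]]; exists g. Qed.

Lemma opp_isomorphic (X Y : C) : @isomorphic (opp_cat C) X Y = isomorphic X Y.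
Proof. by apply/propext; split=> -[f [g [gf fg]]]; exists g, f. Qed.

Lemma opp_zero_object (X : C) : zero_object X -> @zero_object (opp_cat C) X.
Proof. by case. Qed.

Lemma opp_additive : additive_category C -> additive_category (opp_cat C).
Proof.
move=> [[Z Z0] bi]; split; first by exists Z; apply: opp_zero_object.
move=> X Y; have [S [i [j [p [q [pi qj pj qi s]]]]]] := bi X Y.
by exists S, p, q, i, j.
Qed.

End Opposite.

(** * The shift autoequivalence *)

Section Shift.
Variable D : triangulated.
Implicit Types X Y Z : D.

Lemma shift0 X Y : fmap shift (0 : hom X Y) = 0.
Proof.
apply: (addrI (fmap shift (0 : hom X Y))).
by rewrite -shift_additive !addr0.
Qed.

Lemma shiftN X Y (f : hom X Y) : fmap shift (- f) = - fmap shift f.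
Proof.
apply: (addrI (fmap shift f)).
by rewrite -shift_additive !subrr shift0.
Qed.

Lemma unshift_inj X Y (f g : hom X Y) : fmap unshift f = fmap unshift g -> f = g.
Proof.
move=> fg; have [k [_ ks]] := shift_unshift_iso X.
by rewrite -[f]mcompm1 -[g]mcompm1 -ks !mcompA !shift_unshift_nat fg.
Qed.

Lemma shift_inj X Y (f g : hom X Y) : fmap shift f = fmap shift g -> f = g.
Proof.
move=> fg; have [k [_ ks]] := unshift_shift_iso X.
by rewrite -[f]mcompm1 -[g]mcompm1 -ks !mcompA !unshift_shift_nat fg.
Qed.

Lemma shift_full X Y (f : hom (shift X) (shift Y)) : exists g, f = fmap shift g.
Proof.
have [k [ku uk]] := unshift_shift_iso X.
exists (unshift_shift Y \o fmap unshift f \o k).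
apply: unshift_inj.
have [l [lu ul]] := unshift_shift_iso Y.
set g := (_ \o k).
have : g \o unshift_shift X = unshift_shift Y \o fmap unshift f.
  by rewrite -mcompA ku mcompm1.
rewrite unshift_shift_nat => /(congr1 (fun a => l \o a)).
by rewrite !mcompA lu !mcomp1m => ->.
Qed.

Lemma unshift_additive : additive_functor (@unshift D).
Proof.
move=> X Y f g; apply: shift_inj; rewrite shift_additive.
have [k [ks sk]] := shift_unshift_iso Y.
rewrite -[LHS]mcomp1m -[RHS]mcomp1m -ks -!mcompA mcompDr.
by rewrite -!shift_unshift_nat mcompDl.
Qed.

Lemma isomorphic_shift_unshift X : isomorphic (shift (unshift X)) X.
Proof. by exists (shift_unshift X); apply: shift_unshift_iso. Qed.

Lemma isomorphic_unshift_shift X : isomorphic (unshift (shift X)) X.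
Proof. by exists (unshift_shift X); apply: unshift_shift_iso. Qed.

(** The bijection between Hom(X[-1], Z) and Hom(X, Z[1]); it turns the connecting
    morphism of a triangle of the opposite category into one of [D]. *)
Definition hom_transpose X Z (h : hom (unshift X) Z) : hom X (shift Z) :=
  fmap shift h \o inv_iso (shift_unshift_iso X).

Lemma hom_transpose_inj X Z : injective (@hom_transpose X Z).
Proof.
move=> h h'; rewrite /hom_transpose => /(congr1 (fun a => a \o shift_unshift X)).
by rewrite -!mcompA inv_isol !mcompm1 => /shift_inj.
Qed.

Lemma hom_transpose_surj X Z (k : hom X (shift Z)) : exists h, k = hom_transpose h.
Proof.
have [h hE] := shift_full (k \o shift_unshift X); exists h.
by rewrite /hom_transpose -hE -mcompA inv_isor mcompm1.
Qed.

Lemma hom_transpose0 X Z : hom_transpose (0 : hom (unshift X) Z) = 0.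
Proof. by rewrite /hom_transpose shift0 comp0m. Qed.

Lemma hom_transposeMl X Y Z (g : hom Y Z) (h : hom (unshift X) Y) :
  hom_transpose (g \o h) = fmap shift g \o hom_transpose h.
Proof. by rewrite /hom_transpose fmapM mcompA. Qed.

Lemma inv_shift_unshift_nat X Y (f : hom X Y) :
  inv_iso (shift_unshift_iso Y) \o f =
  fmap shift (fmap unshift f) \o inv_iso (shift_unshift_iso X).
Proof.
rewrite -[LHS]mcompm1 -[X in _ \o X = _](inv_isor (shift_unshift_iso X)).
rewrite -!mcompA [f \o _]mcompA shift_unshift_nat.
by rewrite !mcompA inv_isol mcomp1m.
Qed.

Lemma inv_unshift_shift_nat X Y (f : hom X Y) :
  inv_iso (unshift_shift_iso Y) \o f =
  fmap unshift (fmap shift f) \o inv_iso (unshift_shift_iso X).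
Proof.
rewrite -[LHS]mcompm1 -[X in _ \o X = _](inv_isor (unshift_shift_iso X)).
rewrite -!mcompA [f \o _]mcompA unshift_shift_nat.
by rewrite !mcompA inv_isol mcomp1m.
Qed.

Lemma hom_transposeMr X Y Z (h : hom (unshift Y) Z) (f : hom X Y) :
  hom_transpose (h \o fmap unshift f) = hom_transpose h \o f.
Proof.
by rewrite /hom_transpose fmapM -!mcompA inv_shift_unshift_nat.
Qed.

(** Rotating three times negates all three morphisms; the signs on two of them are
    absorbed by the isomorphism (-1, 1, -1). *)
Lemma dist_shiftE X Y Z (f : hom X Y) (g : hom Y Z) (h : hom Z (shift X)) :
  dist f g h <-> dist (fmap shift f) (fmap shift g) (- fmap shift h).
Proof.
have rot3 : dist f g h <-> dist (- fmap shift f) (- fmap shift g) (- fmap shift h).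
  by split=> [/dist_rotate/dist_rotate/dist_rotate|d] //;
    apply/dist_rotate/dist_rotate/dist_rotate.
rewrite rot3; split; apply: (dist_iso (a := - idm _) (b := idm _) (c := - idm _));
  by rewrite ?shiftN ?fmap1 ?(compNm, compmN, mcomp1m, mcompm1, opprK) //;
    do ?[exact: is_iso_oppid|exact: is_iso_id].
Qed.

End Shift.

(** * The opposite triangulated category *)

Section OppositeTriangulated.
Variable D : triangulated.
Let E := opp_cat D.

(** X -> Y -> Z is distinguished in the opposite category when Z -> Y -> X is in
    [D]; as checked in [opp_dist_rotate], transposing the connecting morphism needs
    no sign. *)
Definition opp_dist (X Y Z : E) (f : hom X Y) (g : hom Y Z)
    (h : hom Z (unshift X : E)) : Prop :=
  @dist D Z Y X g f (hom_transpose h).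

Lemma opp_dist_iso (X Y Z X' Y' Z' : E)
    (f : hom X Y) (g : hom Y Z) (h : hom Z (unshift X : E))
    (f' : hom X' Y') (g' : hom Y' Z') (h' : hom Z' (unshift X' : E))
    (a : hom X X') (b : hom Y Y') (c : hom Z Z') :
  is_iso a -> is_iso b -> is_iso c ->
  b \o f = f' \o a -> c \o g = g' \o b ->
  fmap (opp_functor unshift) a \o h = h' \o c ->
  opp_dist f g h -> opp_dist f' g' h'.
Proof.
move=> [a' [a'a aa']] [b' [b'b bb']] [c' [c'c cc']] bf cg ah.
have inv_sq (U V U' V' : E) (u : hom U V) (v : hom U' V') (x : hom U U')
    (y : hom V V') x' y' :
    y \o u = v \o x -> x \o x' = idm _ -> y' \o y = idm _ -> y' \o v = u \o x'.
  move=> e xx' y'y; rewrite -[v]mcompm1 -xx' !mcompA.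
  by rewrite -[y' \o v \o x]mcompA -e mcompA y'y mcomp1m.
apply: (dist_iso (t := D) (a := c') (b := b') (c := a')).
- by exists c.
- by exists b.
- by exists a.
- exact: esym (inv_sq _ _ _ _ _ _ _ _ _ _ cg bb' c'c).
- exact: esym (inv_sq _ _ _ _ _ _ _ _ _ _ bf aa' b'b).
- rewrite -[LHS]hom_transposeMl -[RHS]hom_transposeMr; congr hom_transpose.
  have e : fmap (opp_functor unshift) a' \o fmap (opp_functor unshift) a = idm _.
    by rewrite -fmapM a'a fmap1.
  exact: esym (inv_sq _ _ _ _ _ _ _ _ _ _ ah cc' e).
Qed.

Lemma shift_zero_object (Z : D) : zero_object Z -> zero_object (shift Z).
Proof.
move=> [Z1 _]; apply: zero_object_id.
by rewrite -fmap1 (Z1 _ (idm Z)) shift0.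
Qed.

Lemma opp_dist_id (X Z : E) : zero_object Z ->
  opp_dist (idm X) (0 : hom X Z) (0 : hom Z (unshift X : E)).
Proof.
move=> [Z1 Z2]; have Z0 : @zero_object D Z by split=> W f; [exact: Z2|exact: Z1].
rewrite /opp_dist hom_transpose0; apply/dist_rotate.
have [Y1 Y2] := shift_zero_object Z0.
apply: (dist_iso (t := D) (a := idm _) (b := idm _) (c := idm _))
    (dist_id X (shift_zero_object Z0));
  try exact: is_iso_id; first by [].
- exact: etrans (Y2 _ _) (esym (Y2 _ _)).
- exact: etrans (Y1 _ _) (esym (Y1 _ _)).
Qed.

(** The cone in the opposite category is the fibre, that is, the cone shifted by
    -1. *)
Lemma opp_dist_cone (X Y : E) (f : hom X Y) :
  exists (Z : E) (g : hom Y Z) (h : hom Z (unshift X : E)), opp_dist f g h.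
Proof.
have [Z [p [q d]]] := @dist_cone D Y X f.
have [h hE] := hom_transpose_surj (inv_iso (shift_unshift_iso Z) \o p).
have [g gE] := shift_full (- (q \o shift_unshift Z)).
exists (unshift Z), g, h; rewrite /opp_dist -hE; apply/dist_rotate.
apply: (dist_iso (t := D) (a := idm _) (b := idm _)
          (c := inv_iso (shift_unshift_iso Z))) d;
  rewrite ?fmap1 ?mcompm1 ?mcomp1m -?gE ?opprK //;
  do ?[exact: is_iso_id|exact: is_iso_inv].
by rewrite -mcompA inv_isor mcompm1.
Qed.

(** Rotation in [D] leaves a sign, which is absorbed by identifying X[-1][1] with X
    through minus the counit. *)
Lemma opp_dist_rotate (X Y Z : E)
    (f : hom X Y) (g : hom Y Z) (h : hom Z (unshift X : E)) :
  opp_dist f g h <-> opp_dist g h (- fmap (opp_functor unshift) f).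
Proof.
rewrite /opp_dist /hom_transpose /= shiftN compNm -inv_shift_unshift_nat.
set s := shift_unshift_iso X; set k := fmap shift h \o _.
rewrite (dist_rotate (h : hom (unshift X : D) Z)) /=.
have kE : k \o shift_unshift X = fmap shift h.
  by rewrite /k -mcompA inv_isol mcompm1.
split=> d.
  apply: (dist_iso (t := D) (a := idm _) (b := idm _) (c := - inv_iso s)) d.
  - exact: is_iso_id.
  - exact: is_iso_id.
  - by exists (- shift_unshift X);
      rewrite !compNm !compmN !opprK inv_isol inv_isor.
  - by rewrite mcompm1 mcomp1m.
  - by rewrite compNm mcompm1.
  - by rewrite fmap1 mcomp1m compNm compmN opprK.
apply: (dist_iso (t := D) (a := idm _) (b := idm _) (c := - shift_unshift X)) d.
- exact: is_iso_id.
- exact: is_iso_id.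
- by exists (- inv_iso s); rewrite !compNm !compmN !opprK inv_isol inv_isor.
- by rewrite mcompm1 mcomp1m.
- by rewrite mcompm1 compNm compmN opprK mcompA inv_isor mcomp1m.
- by rewrite fmap1 mcomp1m compmN kE.
Qed.

Lemma opp_dist_fill (X Y Z X' Y' Z' : E)
    (f : hom X Y) (g : hom Y Z) (h : hom Z (unshift X : E))
    (f' : hom X' Y') (g' : hom Y' Z') (h' : hom Z' (unshift X' : E))
    (a : hom X X') (b : hom Y Y') :
  opp_dist f g h -> opp_dist f' g' h' -> b \o f = f' \o a ->
  exists c : hom Z Z',
    c \o g = g' \o b /\ fmap (opp_functor unshift) a \o h = h' \o c.
Proof.
move=> /dist_rotate d /dist_rotate d' e.
have [c0 [ce1 ce2]] := dist_fill (t := D) (a := b) (b := a) d' d (esym e).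
have [c cE] := shift_full c0; rewrite {}cE {c0} in ce1 ce2.
exists c; split.
  apply: (@shift_inj D); rewrite /= !fmapM; apply: oppr_inj.
  by rewrite -compNm -compmN ce2.
apply: (@hom_transpose_inj D).
by rewrite [LHS]hom_transposeMr [RHS]hom_transposeMl.
Qed.

(** Rotated once, the three given triangles are the cones of the two composable
    morphisms and of their composite in [D], and the octahedron of [D] is built on
    shifted objects; fullness and faithfulness of the shift bring it back. *)
Lemma opp_dist_octahedron (X Y Z Q1 Q2 Q3 : E)
    (f : hom X Y) (p1 : hom Y Q1) (d1 : hom Q1 (unshift X : E))
    (g : hom Y Z) (p2 : hom Z Q2) (d2 : hom Q2 (unshift X : E))
    (p3 : hom Z Q3) (d3 : hom Q3 (unshift Y : E)) :
  opp_dist f p1 d1 -> opp_dist (g \o f) p2 d2 -> opp_dist g p3 d3 ->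
  exists (a : hom Q1 Q2) (b : hom Q2 Q3),
    [/\ opp_dist a b (fmap (opp_functor unshift) p1 \o d3),
        a \o p1 = p2 \o g, d2 \o a = d1,
        b \o p2 = p3 & d3 \o b = fmap (opp_functor unshift) f \o d2].
Proof.
move=> /dist_rotate d1' /dist_rotate d2' /dist_rotate d3'.
have [b' [a' [d e1 e2 e3 e4]]] := dist_octahedron (t := D) d3' d2' d1'.
have [b bE] := shift_full b'; have [a aE] := shift_full a'.
rewrite {}bE {}aE in d e1 e2 e3 e4; exists a, b; split.
- apply/dist_shiftE; rewrite [hom_transpose _]hom_transposeMr fmapM -compmN.
  exact: d.
- apply: (@shift_inj D); rewrite /= !fmapM; apply: oppr_inj.
  by rewrite -compNm e4 compmN.
- apply: (@hom_transpose_inj D).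
  by rewrite [LHS]hom_transposeMl.
- apply: (@shift_inj D); rewrite /= !fmapM; apply: oppr_inj.
  by rewrite -compNm e2.
- apply: (@hom_transpose_inj D).
  by rewrite [LHS]hom_transposeMl [RHS]hom_transposeMr.
Qed.

Definition opp_tri : triangulated :=
  @Triangulated E (opp_additive (tadditive D))
    (opp_functor unshift) (opp_functor shift)
    (fun X Y f g => @unshift_additive D Y X f g)
    (fun X => inv_iso (unshift_shift_iso X))
    (fun X => opp_is_iso (is_iso_inv (unshift_shift_iso X)))
    (fun X Y f => inv_unshift_shift_nat f)
    (fun X => inv_iso (shift_unshift_iso X))
    (fun X => opp_is_iso (is_iso_inv (shift_unshift_iso X)))
    (fun X Y f => inv_shift_unshift_nat f)
    opp_dist opp_dist_iso opp_dist_id opp_dist_cone opp_dist_rotate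
    opp_dist_fill opp_dist_octahedron.

End OppositeTriangulated.

(** * Triangles without connecting morphism *)

(** Dropping the connecting morphism makes the signs disappear and the notion
    self-dual. *)
Definition tri (D : triangulated) (X Y Z : D) (f : hom X Y) (g : hom Y Z) : Prop :=
  exists h : hom Z (shift X), dist f g h.

Lemma opp_tri_tri (D : triangulated) (X Y Z : D) (f : hom X Y) (g : hom Y Z) :
  @tri (opp_tri D) Z Y X g f <-> tri f g.
Proof.
split=> [[h d]|[h d]]; first by exists (hom_transpose h).
by have [k kE] := hom_transpose_surj h; exists k; rewrite kE in d.
Qed.

Section Tri.
Variable D : triangulated.
Implicit Types X Y Z W : D.

Lemma tri_rot X Y Z (f : hom X Y) (g : hom Y Z) :
  tri f g -> exists h : hom Z (shift X), tri g h.
Proof. by move=> [h /dist_rotate d]; exists h, (- fmap shift f). Qed.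

Lemma tri_cone X Y (f : hom X Y) : exists Z (g : hom Y Z), tri f g.
Proof. by have [Z [g [h d]]] := dist_cone f; exists Z, g, h. Qed.

Lemma tri_shift X Y Z (f : hom X Y) (g : hom Y Z) :
  tri f g -> tri (fmap shift f) (fmap shift g).
Proof. by move=> [h /dist_shiftE d]; exists (- fmap shift h). Qed.

Lemma tri_id X Z : zero_object Z -> tri (idm X) (0 : hom X Z).
Proof. by move=> Z0; exists 0; apply: dist_id. Qed.

(** The rotation of the triangle W = W -> 0. *)
Lemma dist_0id O W : zero_object O -> dist (0 : hom O W) (idm W) 0.
Proof.
move=> O0; apply/dist_rotate; rewrite shift0 oppr0.
exact: dist_id (shift_zero_object O0).
Qed.

Lemma tri_comp X Y Z (f : hom X Y) (g : hom Y Z) : tri f g -> g \o f = 0.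
Proof.
move=> [h d]; have [[O O0] _] := tadditive D.
have [c [ce _]] := dist_fill (a := idm X) (b := f) (dist_id X O0) d erefl.
by rewrite -ce compm0.
Qed.

Lemma tri_desc X Y Z W (f : hom X Y) (g : hom Y Z) (u : hom Y W) :
  tri f g -> u \o f = 0 -> exists v : hom Z W, u = v \o g.
Proof.
move=> [h d] uf; have [[O O0] _] := tadditive D.
have [|v [vg _]] := dist_fill (a := 0) (b := u) d (dist_0id W O0).
  by rewrite uf comp0m.
by exists v; rewrite vg mcomp1m.
Qed.

End Tri.

Section DualTriangles.
Variable D : triangulated.
Implicit Types X Y Z W : D.

Lemma tri_unrot X Y Z (f : hom X Y) (g : hom Y Z) :
  tri f g -> exists h : hom (unshift Z) X, tri h f.
Proof.
by move=> /opp_tri_tri/tri_rot[h /opp_tri_tri hf]; exists h.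
Qed.

Lemma tri_cocone Y Z (g : hom Y Z) : exists X (f : hom X Y), tri f g.
Proof.
by have [X [f /opp_tri_tri fg]] := @tri_cone (opp_tri D) Z Y g; exists X, f.
Qed.

Lemma tri_unshift X Y Z (f : hom X Y) (g : hom Y Z) :
  tri f g -> tri (fmap unshift f) (fmap unshift g).
Proof. by move=> /opp_tri_tri/tri_shift/opp_tri_tri. Qed.

Lemma tri_lift X Y Z W (f : hom X Y) (g : hom Y Z) (u : hom W Y) :
  tri f g -> g \o u = 0 -> exists v : hom W X, u = f \o v.
Proof. by move=> /opp_tri_tri fg gu; exact: (tri_desc fg gu). Qed.

(** The octahedron on the cones of f, of g f and of g. *)
Lemma tri_octahedron X Y Z Q1 Q2 Q3 (f : hom X Y) (p1 : hom Y Q1)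
    (g : hom Y Z) (p3 : hom Z Q3) (p2 : hom Z Q2) :
  tri f p1 -> tri g p3 -> tri (g \o f) p2 ->
  exists (a : hom Q1 Q2) (b : hom Q2 Q3),
    [/\ tri a b, a \o p1 = p2 \o g & b \o p2 = p3].
Proof.
move=> [d1 t1] [d3 t3] [d2 t2].
have [a [b [t ap _ bp _]]] := dist_octahedron t1 t2 t3.
by exists a, b; split=> //; exists (fmap shift p1 \o d3).
Qed.

End DualTriangles.

Section Exactness.
Variable D : triangulated.
Implicit Types X Y Z W : D.

(** The octahedron on the fibres of f, of g f and of g: the octahedron of the
    opposite category. *)
Lemma tri_cooctahedron X Y Z K1 K2 K3 (k1 : hom K1 X) (f : hom X Y)
    (k3 : hom K3 Y) (g : hom Y Z) (k2 : hom K2 X) :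
  tri k1 f -> tri k3 g -> tri k2 (g \o f) ->
  exists (a : hom K1 K2) (b : hom K2 K3),
    [/\ tri a b, k2 \o a = k1 & k3 \o b = f \o k2].
Proof.
move=> /opp_tri_tri t1 /opp_tri_tri t3 /opp_tri_tri t2.
have [b [a [/opp_tri_tri t kb ka]]] := tri_octahedron t3 t1 t2.
by exists a, b.
Qed.

Definition exact3 X Y Z := exists (f : hom X Y) (g : hom Y Z), tri f g.

Lemma tri_exact3 X Y Z (f : hom X Y) (g : hom Y Z) : tri f g -> exact3 X Y Z.
Proof. by exists f, g. Qed.

Lemma exact3_iso X Y Z X' Y' Z' : isomorphic X X' -> isomorphic Y Y' ->
  isomorphic Z Z' -> exact3 X Y Z -> exact3 X' Y' Z'.
Proof.
move=> [a [a' [a'a aa']]] [b [b' [b'b bb']]] [c [c' [c'c cc']]] [f [g [h d]]].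
exists (b \o f \o a'), (c \o g \o b'), (fmap shift a \o h \o c').
apply: (dist_iso (a := a) (b := b) (c := c)) d; first by exists a'.
- by exists b'.
- by exists c'.
- by rewrite -!mcompA a'a mcompm1.
- by rewrite -!mcompA b'b mcompm1.
- by rewrite -!mcompA c'c mcompm1.
Qed.

Lemma exact3_rot X Y Z : exact3 X Y Z -> exact3 Y Z (shift X).
Proof. by move=> [f [g /tri_rot[h t]]]; exists g, h. Qed.

Lemma exact3_unrot X Y Z : exact3 X Y Z -> exact3 (unshift Z) X Y.
Proof. by move=> [f [g /tri_unrot[h t]]]; exists h, f. Qed.

Lemma exact3_shift X Y Z : exact3 X Y Z -> exact3 (shift X) (shift Y) (shift Z).
Proof. by move=> [f [g /tri_shift t]]; exists (fmap shift f), (fmap shift g). Qed.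

Lemma exact3_unshift X Y Z :
  exact3 X Y Z -> exact3 (unshift X) (unshift Y) (unshift Z).
Proof.
by move=> [f [g /tri_unshift t]]; exists (fmap unshift f), (fmap unshift g).
Qed.

Definition hom0 X Y := forall f : hom X Y, f = 0.

Lemma hom0_isor X Y Y' : isomorphic Y Y' -> hom0 X Y -> hom0 X Y'.
Proof.
move=> [a [a' [_ aa']]] XY f.
by rewrite -[f]mcomp1m -aa' -mcompA (XY (a' \o f)) compm0.
Qed.

Lemma hom0_shift X Y : hom0 (shift X) Y <-> hom0 X (unshift Y).
Proof.
split=> XY f.
  apply: shift_inj; rewrite shift0.
  apply: (@hom0_isor _ Y) => //.
  exact: isomorphic_sym (isomorphic_shift_unshift Y).
apply: (@hom0_isor _ (shift (unshift Y))); first exact: isomorphic_shift_unshift.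
by move=> g; have [k ->] := shift_full g; rewrite (XY k) shift0.
Qed.

Lemma hom0_shift2 X Y : hom0 (shift X) (shift Y) <-> hom0 X Y.
Proof.
rewrite hom0_shift; split; apply: hom0_isor; [|apply: isomorphic_sym];
  exact: isomorphic_unshift_shift.
Qed.

Lemma hom0_extl X Y Z W : exact3 X Y Z -> hom0 X W -> hom0 Z W -> hom0 Y W.
Proof.
move=> [f [g t]] XW ZW u; have [v ->] := tri_desc t (XW (u \o f)).
by rewrite (ZW v) comp0m.
Qed.

Lemma hom0_extr X Y Z W : exact3 X Y Z -> hom0 W X -> hom0 W Z -> hom0 W Y.
Proof.
move=> [f [g t]] WX WZ u; have [v ->] := tri_lift t (WZ (g \o u)).
by rewrite (WX v) compm0.
Qed.

End Exactness.

Lemma opp_exact3 (D : triangulated) (X Y Z : D) :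
  @exact3 (opp_tri D) Z Y X <-> exact3 X Y Z.
Proof. by split=> -[g [f /opp_tri_tri t]]; exists f, g. Qed.

(** * t-structures from their connective part *)

Section TStructures.
Variable D : triangulated.
Implicit Types (X Y Z W : D) (t : tpair D).

Lemma ge_part1E t Z : is_tstructure t -> ge_part t 1 Z <-> coconn t (shift Z).
Proof.
move=> ts; split=> [[Y Yt i]|Zt].
  apply: (coconn_iso ts) Yt; apply: isomorphic_trans (isomorphic_fobj shift i).
  exact: isomorphic_sym (isomorphic_shift_unshift Y).
by exists (shift Z) => //; apply: isomorphic_unshift_shift.
Qed.

Lemma conn_shift t X : is_tstructure t -> conn t X -> conn t (shift X).
Proof.
move=> ts /(conn_le1 ts)[Y Yt i]; apply: (conn_iso ts) Yt.
apply: isomorphic_trans (isomorphic_fobj shift i).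
exact: isomorphic_sym (isomorphic_shift_unshift Y).
Qed.

Lemma coconn_unshift t X : is_tstructure t -> coconn t X -> coconn t (unshift X).
Proof.
move=> ts Xt; apply: (coconn_ge1 ts); exists X => //; exact: isomorphic_refl.
Qed.

Lemma t_orth t X Y : is_tstructure t -> conn t X -> coconn t Y -> hom0 (shift X) Y.
Proof.
move=> ts Xt Yt; apply/hom0_shift; apply: (t_orthogonal ts) => //.
by exists Y => //; apply: isomorphic_refl.
Qed.

Lemma t_trunc t X : is_tstructure t -> exists Y Z,
  [/\ conn t Y, coconn t (shift Z) & exact3 Y X Z].
Proof.
move=> ts; have [Y [Z [f [g [h [Yt /(ge_part1E _ ts) Zt d]]]]]] := t_triangle ts X.
by exists Y, Z; split=> //; exists f, g, h.
Qed.

Lemma tri_zero_iso X Y Z (f : hom X Y) (g : hom Y Z) :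
  tri f g -> zero_object Z -> is_iso f.
Proof.
move=> t Z0; have [_ Z0r] := Z0.
have [s fs] := tri_lift t (Z0r _ (g \o idm Y)).
exists s; split=> //; apply/eqP; rewrite -subr_eq0; apply/eqP.
have [h t'] := tri_unrot t.
have [|v ->] := tri_lift (u := (s \o f) - idm X) t'.
  by rewrite compmB mcompA -fs mcomp1m mcompm1 subrr.
have [uZl _] := zero_object_iso Z0 (isomorphic_sym (isomorphic_shift_unshift Z)).
have h0 : h = 0 by apply: shift_inj; rewrite (uZl _ (fmap shift h)) shift0.
by rewrite h0 comp0m.
Qed.

(** If X is orthogonal to all Z in degrees at least 1, its truncation X -> Z
    vanishes, so Z is a direct summand of Y[1], to which it is orthogonal; hence Z = 0
    and X is its own connective part. *)
Lemma connE t X : is_tstructure t ->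
  conn t X <-> forall Z, coconn t Z -> hom0 (shift X) Z.
Proof.
move=> ts; split=> [Xt Z|X0]; first exact: t_orth.
have [Y [Z [Yt Zt [f [g fg]]]]] := t_trunc X ts.
have /hom0_shift2 XZ := X0 _ Zt; have g0 := XZ g.
have [h gh] := tri_rot fg.
have [|v idv] := tri_desc (u := idm Z) gh; first by rewrite g0 compm0.
have /hom0_shift2 YZ : hom0 (shift (shift Y)) (shift Z).
  exact: t_orth ts (conn_shift ts Yt) Zt.
apply: (conn_iso ts) Yt; exists f; apply: tri_zero_iso fg _.
by apply: zero_object_id; rewrite idv (YZ v) comp0m.
Qed.

(** The truncation triangle with Y[1] in degrees below 0 and Z in degrees at least
    0; it is the dual of [t_trunc]. *)
Lemma t_trunc_lt0 t X : is_tstructure t -> exists Y Z,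
  [/\ conn t Y, coconn t Z & exact3 (shift Y) X Z].
Proof.
move=> ts; have [Y [Z [Yt Zt e]]] := t_trunc (unshift X) ts.
exists Y, (shift Z); split=> //; apply: exact3_iso (exact3_shift e);
  by [exact: isomorphic_refl|exact: isomorphic_shift_unshift].
Qed.

(** A shift-stable class with truncation triangles determines a t-structure, the
    coconnective part being forced.  The connectively induced pairs have exactly
    this shape. *)
Lemma aisle_tstructure (U : set D) :
  (forall X Y, isomorphic X Y -> U X -> U Y) ->
  (forall X, U X -> U (shift X)) ->
  (forall X, exists Y Z,
     [/\ U Y, forall W, U W -> hom0 W Z & exact3 Y X Z]) ->
  is_tstructure (TPair U [set X | forall W, U W -> hom0 (shift W) X]).
Proof.
move=> Uiso Ushift Utrunc; split=> /=.
- exact: Uiso.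
- by move=> X Y i X0 W UW; apply: hom0_isor i (X0 W UW).
- move=> X UX; exists (shift X); first exact: Ushift.
  exact: isomorphic_unshift_shift.
- move=> X [Y Y0 i] W UW; apply: hom0_isor i _.
  exact: (hom0_shift _ _).1 (Y0 _ (Ushift _ UW)).
- by move=> X Y UX [Z Z0 i]; apply: hom0_isor i _; apply/hom0_shift/Z0.
- move=> X; have [Y [Z [UY Z0 [f [g [h d]]]]]] := Utrunc X.
  exists Y, Z, f, g, h; split=> //; exists (shift Z).
    by move=> W UW; apply/hom0_shift2/Z0.
  exact: isomorphic_unshift_shift.
Qed.

End TStructures.

Definition opp_tpair (D : triangulated) (t : tpair D) : tpair (opp_tri D) :=
  @TPair (opp_tri D) (coconn t) (conn t).

(** Both parts of a t-structure determine each other, so the coconnective part is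
    an aisle of the opposite category. *)
Lemma opp_tstructure (D : triangulated) (t : tpair D) :
  is_tstructure t -> is_tstructure (opp_tpair t).
Proof.
move=> ts; rewrite /opp_tpair.
have -> : conn t = [set X : opp_tri D | forall W : opp_tri D, coconn t W ->
    @hom0 (opp_tri D) (shift W) X].
  apply/seteqP; split=> X.
    by move=> Xt W Wt; exact: ((@hom0_shift D X W).1 (t_orth ts Xt Wt)).
  move=> X0; apply: (@connE D t X ts).2 => Z Zt.
  by apply: (@hom0_shift D X Z).2; exact: X0.
apply: aisle_tstructure.
- by move=> X Y; rewrite opp_isomorphic; exact: (coconn_iso ts).
- by move=> X; exact: (@coconn_unshift D t X ts).
- move=> X; have [Y [Z [Yt Zt e]]] := @t_trunc_lt0 D t X ts.
  exists Z, (shift Y); split=> //; last exact/opp_exact3.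
  by move=> W Wt; exact: (t_orth ts Yt Wt).
Qed.

(** The inverse of [opp_tpair].  It is separate because the opposite of [opp_tri D]
    is not convertible to [D], its distinguished triangles being defined by a double
    transposition. *)
Definition unopp_tpair (D : triangulated) (t : tpair (opp_tri D)) : tpair D :=
  @TPair D (coconn t) (conn t).

Lemma unopp_tstructure (D : triangulated) (t : tpair (opp_tri D)) :
  is_tstructure t -> is_tstructure (unopp_tpair t).
Proof.
move=> ts; rewrite /unopp_tpair.
have -> : conn t = [set X : D | forall W : D, coconn t W -> hom0 (shift W) X].
  apply/seteqP; split=> X.
    move=> Xt W Wt; exact: ((@hom0_shift (opp_tri D) X W).1 (t_orth ts Xt Wt)).
  move=> X0; apply: (@connE (opp_tri D) t X ts).2 => Z Zt.
  by apply: (@hom0_shift (opp_tri D) X Z).2; exact: X0.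
apply: aisle_tstructure.
- by move=> X Y; rewrite -opp_isomorphic; exact: (coconn_iso ts).
- by move=> X Xt; exact: (coconn_unshift ts Xt).
- move=> X; have [Y [Z [Yt Zt /opp_exact3 e]]] := @t_trunc_lt0 (opp_tri D) t X ts.
  exists Z, (@unshift D Y); split=> //.
  by move=> W Wt; exact: (@t_orth (opp_tri D) t Y W ts Yt Wt).
Qed.

Section TStructureClosure.
Variables (D : triangulated) (t : tpair D).
Hypothesis ts : is_tstructure t.
Implicit Types (X Y Z W : D).

Lemma coconnE X : coconn t X <-> forall Z, conn t Z -> hom0 (shift Z) X.
Proof.
have oE := @connE (opp_tri D) (opp_tpair t) X (opp_tstructure ts).
split=> [/oE.1 X0 Z Zt|X0]; first exact: (@hom0_shift D Z X).2 (X0 Z Zt).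
by apply: oE.2 => Z Zt; exact: (@hom0_shift D Z X).1 (X0 Z Zt).
Qed.

Lemma conn_ext X Y Z : exact3 X Y Z -> conn t X -> conn t Z -> conn t Y.
Proof.
move=> /exact3_shift e /(connE _ ts) X0 /(connE _ ts) Z0; apply/(connE _ ts) => W Wt.
by apply: hom0_extl e _ _; [exact: X0|exact: Z0].
Qed.

Lemma coconn_ext X Y Z : exact3 X Y Z -> coconn t X -> coconn t Z -> coconn t Y.
Proof.
move=> e /coconnE X0 /coconnE Z0; apply/coconnE => W Wt.
by apply: hom0_extr e _ _; [exact: X0|exact: Z0].
Qed.

Lemma conn_retract X Y (i : hom X Y) (p : hom Y X) :
  p \o i = idm X -> conn t Y -> conn t X.
Proof.
move=> pi /(connE _ ts) Y0; apply/(connE _ ts) => Z Zt f.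
by rewrite -[f]mcompm1 -fmap1 -pi fmapM mcompA (Y0 Z Zt (f \o _)) comp0m.
Qed.

Lemma conn_zero X : zero_object X -> conn t X.
Proof.
by move=> /shift_zero_object[X0 _]; apply/(connE _ ts) => Z _; exact: X0.
Qed.

Lemma coconn_zero X : zero_object X -> coconn t X.
Proof. by move=> [_ X0]; apply/coconnE => Z _; exact: X0. Qed.

Lemma conn_iter m n X : (m <= n)%N ->
  conn t (iter m shift X) -> conn t (iter n shift X).
Proof.
move=> /subnKC <-; elim: (n - m)%N => [|k IH] Xt; first by rewrite addn0.
by rewrite addnS; apply: conn_shift => //; apply: IH.
Qed.

End TStructureClosure.

Section Iter.
Variable D : triangulated.
Implicit Types (X Y : D) (n : nat).

Lemma isomorphic_iter (F : functor D D) n X Y :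
  isomorphic X Y -> isomorphic (iter n F X) (iter n F Y).
Proof. by move=> i; elim: n => //= n; apply: isomorphic_fobj. Qed.

Lemma isomorphic_iter_unshiftK n X : isomorphic (iter n shift (iter n unshift X)) X.
Proof.
elim: n => [|n IH]; first exact: isomorphic_refl.
rewrite iterSr /=; apply: isomorphic_trans IH; apply: isomorphic_iter.
exact: isomorphic_shift_unshift.
Qed.

Lemma isomorphic_iter_shiftK n X : isomorphic (iter n unshift (iter n shift X)) X.
Proof.
elim: n => [|n IH]; first exact: isomorphic_refl.
rewrite iterSr /=; apply: isomorphic_trans IH; apply: isomorphic_iter.
exact: isomorphic_unshift_shift.
Qed.

(** As the connective part is stable under the shift, a natural number of shifts is
    enough; this avoids all arithmetic on integer shifts. *)
Lemma tminusE (t : tpair D) X : is_tstructure t ->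
  tminus t X <-> exists n, conn t (iter n shift X).
Proof.
move=> ts; split=> [[m _ [Y Yt]]|[n Xt]]; last first.
  exists (Posz n) => //; exists (iter n shift X) => //.
  by case: n {Xt} => [|n];
    [exact: (isomorphic_iter_shiftK 0 X)|exact: (isomorphic_iter_shiftK n.+1 X)].
case: m => [[|m]|m] i.
- by exists 0%N; apply: (conn_iso ts) Yt.
- exists m.+1; apply: (conn_iso ts) Yt; apply: isomorphic_sym.
  apply: isomorphic_trans (isomorphic_iter_unshiftK m.+1 Y).
  exact: isomorphic_iter (isomorphic_sym i).
- exists 0%N; apply: (conn_iso ts i).
  exact: (@conn_iter _ _ ts 0 m.+1).
Qed.

Lemma tplusE (t : tpair D) X : is_tstructure t ->
  tplus t X <-> exists n, coconn t (iter n unshift X).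
Proof.
move=> ts; have ots := opp_tstructure ts.
split=> [[m _ [Y Yt]]|[n Xt]]; last first.
  exists (- Posz n) => //; exists (iter n unshift X) => //.
  by rewrite opprK; exact: isomorphic_iter_unshiftK.
case: m => [[|m]|m] i.
- by exists 0%N; apply: (coconn_iso ts) Yt.
- exists 0%N; apply: (coconn_iso ts i).
  exact: (@conn_iter _ _ ots 0 m.+1).
- exists m.+1; apply: (coconn_iso ts) Yt; apply: isomorphic_sym.
  apply: isomorphic_trans (isomorphic_iter_shiftK m.+1 Y).
  exact: isomorphic_iter (isomorphic_sym i).
Qed.

End Iter.

(** * Semiorthogonal decompositions *)

Section Subcategory.
Variables (D : triangulated) (A : tri_sub D).
Implicit Types X Y Z : D.

Lemma sub_ext X Y Z : exact3 X Y Z -> A X -> A Z -> A Y.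
Proof.
move=> /exact3_unrot[f [g [h d]]] AX AZ.
exact: sub_cone d (sub_unshift AZ) AX.
Qed.

Lemma sub_cone3 X Y Z : exact3 X Y Z -> A X -> A Y -> A Z.
Proof. by move=> [f [g [h d]]]; apply: sub_cone d. Qed.

Lemma sval_iter_shift n (K : subcat A) :
  sval (iter n shift K) = iter n shift (sval K).
Proof. by elim: n => //= n ->. Qed.

Lemma sval_iter_unshift n (K : subcat A) :
  sval (iter n unshift K) = iter n unshift (sval K).
Proof. by elim: n => //= n ->. Qed.

End Subcategory.

(** A self-dual form of a semiorthogonal decomposition. *)
Definition orthogonal_decomposition (D : triangulated) (B C : tri_sub D) : Prop :=
  (forall X Y : D, C X -> B Y -> hom0 X Y) /\
  (forall X : D, exists K Q : D, [/\ C K, B Q & exact3 K X Q]).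

Lemma semiorthogonal_decomposition (D : triangulated) (B C : tri_sub D) :
  semiorthogonal B C -> orthogonal_decomposition B C.
Proof.
move=> [orth dec]; split=> [X Y CX BY|X]; first exact: (orth X Y 0).
have [K [Q [f [g [h [CK BQ d]]]]]] := dec X.
by exists K, Q; split=> //; exists f, g, h.
Qed.

Section Decomposition.
Variables (D : triangulated) (B C : tri_sub D).
Hypothesis sod : orthogonal_decomposition B C.
Implicit Types X Y Z K Q : D.

(** Up to isomorphism K is gamma gamma^! X ([cpart_gshriek]).  A relation is more
    convenient than the functor: shifts and extensions of decomposition triangles
    are again decomposition triangles, so exactness of gamma^! is never invoked. *)
Definition cpart X K := exists Q, [/\ C K, B Q & exact3 K X Q].

Lemma cpart_exists X : exists K, cpart X K.
Proof. by have [K [Q e]] := sod.2 X; exists K, Q. Qed.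

Lemma cpart_refl K : C K -> cpart K K.
Proof.
have [[O O0] _] := tadditive D; exists O; split=> //; first exact: sub_zero.
by exists (idm K), 0; apply: tri_id.
Qed.

Lemma cpart_iso X X' K K' :
  isomorphic X X' -> isomorphic K K' -> cpart X K -> cpart X' K'.
Proof.
move=> iX iK [Q [CK BQ e]]; exists Q; split=> //; first exact: sub_iso iK CK.
exact: exact3_iso iK iX (isomorphic_refl Q) e.
Qed.

Lemma cpart_shift X K : cpart X K -> cpart (shift X) (shift K).
Proof.
move=> [Q [CK BQ e]]; exists (shift Q).
by split; [exact: sub_shift|exact: sub_shift|exact: exact3_shift].
Qed.

Lemma cpart_unshift X K : cpart X K -> cpart (unshift X) (unshift K).
Proof.
move=> [Q [CK BQ e]]; exists (unshift Q).
by split; [exact: sub_unshift|exact: sub_unshift|exact: exact3_unshift].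
Qed.

Lemma cpart_iter_shift n X K :
  cpart X K -> cpart (iter n shift X) (iter n shift K).
Proof. by move=> c; elim: n => //= n; apply: cpart_shift. Qed.

Lemma cpart_iter_unshift n X K :
  cpart X K -> cpart (iter n unshift X) (iter n unshift K).
Proof. by move=> c; elim: n => //= n; apply: cpart_unshift. Qed.

Section Coreflection.
Variables (gshriek : functor D (subcat C)) (adjg : adjunction (incl C) gshriek).

(** Both K -> X and the counit are universal among morphisms from [C] to X, the
    former because [C] is orthogonal to [B] and the latter by adjunction. *)
Lemma cpart_gshriek X K : cpart X K -> isomorphic (incl C (gshriek X)) K.
Proof.
move=> [Q [CK BQ [k [q t]]]].
pose K' : subcat C := exist _ K CK.
pose eps : hom (incl C (gshriek X)) X := acounit adjg X.
have eps_inj (Y : subcat C) (u v : hom (incl C Y) (incl C (gshriek X))) :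
    eps \o u = eps \o v -> u = v.
  move=> uv.
  (* w is recovered from its transpose eps w. *)
  have transp (w : hom Y (gshriek X)) :
      w = fmap gshriek (eps \o (w : hom (incl C Y) _)) \o aunit adjg Y.
    rewrite fmapM -mcompA -[fmap gshriek w]/(fmap gshriek (fmap (incl C) w)).
    by rewrite -aunit_nat mcompA adj_triangleG mcomp1m.
  by rewrite (transp u) (transp v) uv.
have k_inj (u v : hom K K) : k \o u = k \o v -> u = v.
  move=> uv; have [h hk] := tri_unrot t.
  have [|w /eqP] := tri_lift (u := u - v) hk; first by rewrite compmB uv subrr.
  rewrite (sod.1 _ _ CK (sub_unshift BQ) w) compm0 subr_eq0.
  by move=> /eqP.
have [e epsE] := tri_lift t (sod.1 _ _ (svalP (gshriek X)) BQ (q \o eps)).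
pose k' : hom K (incl C (gshriek X)) :=
  fmap gshriek (k : hom (incl C K') X) \o aunit adjg K'.
have kE : k = eps \o k'.
  rewrite /eps /k' -[_ \o aunit adjg K']/(fmap (incl C) _) fmapM mcompA -acounit_nat -mcompA.
  by have := congr1 (fun a => k \o a) (adj_triangleF adjg K'); rewrite mcompm1.
exists e, k'; split.
  by apply: (eps_inj (gshriek X)); rewrite mcompA -kE -epsE mcompm1.
by apply: k_inj; rewrite mcompA -epsE -kE mcompm1.
Qed.

Lemma cpart_uniq X K K' : cpart X K -> cpart X K' -> isomorphic K K'.
Proof.
move=> /cpart_gshriek i /cpart_gshriek; apply: isomorphic_trans.
exact: isomorphic_sym.
Qed.

Lemma ess_image_gshriek (P : set D) :
  ess_image gshriek P = [set K | exists2 X, P X & cpart X (incl C K)].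
Proof.
apply/seteqP; split=> K [X PX i]; exists X => //.
  have [K' cK'] := cpart_exists X; apply: cpart_iso (cK'); first exact: isomorphic_refl.
  exact: isomorphic_trans (isomorphic_sym (cpart_gshriek cK')) i.
exact: cpart_gshriek i.
Qed.

End Coreflection.

Section Induced.
Variable t : tpair D.
Hypothesis ts : is_tstructure t.
Hypothesis stab : forall X K, cpart X K -> conn t X -> conn t K.
Let u := tconn_induced t C.

(** For X in [C] with truncation Y -> X -> Z, replace Y by its [C]-part K and Z by
    the cone Z' of K -> X.  Then Z' is an extension of Z by the [B]-part of Y, and
    objects of [C] have no morphisms to that [B]-part. *)
Lemma stable_connectively_induces : connectively_induces t C.
Proof.
apply: (@aisle_tstructure (subcat C) (incl C @^-1` conn t)).
- by move=> X Y; apply: (conn_iso ts).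
- by move=> X; apply: (conn_shift ts).
move=> [X CX]; have [Y [Z [Yt Zt [y [z t1]]]]] := t_trunc X ts.
have [K cK] := cpart_exists Y; have Kt := stab cK Yt.
have [Q [CK BQ [k [q t2]]]] := cK.
have [Z' [z' t3]] := tri_cone (y \o k).
have CZ' : C Z' := sub_cone3 (tri_exact3 t3) CK CX.
have [a [b [t4 _ _]]] := tri_octahedron t2 t1 t3.
exists (exist _ K CK), (exist _ Z' CZ'); split=> //; last by exists (y \o k), z'.
move=> [W CW] Wt; apply: (hom0_extr (tri_exact3 t4) (sod.1 _ _ CW BQ)).
exact/hom0_shift2/(t_orth ts).
Qed.

Let us : is_tstructure u := stable_connectively_induces.

Lemma cpart_coconn X (K : subcat C) :
  cpart X (incl C K) -> coconn t X -> coconn u K.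
Proof.
move=> [Q [CK BQ [k [q t1]]]] Xt Y Yt f; have [h t2] := tri_unrot t1.
have [v ->] := tri_lift t2 (t_orth ts Yt Xt (k \o (f : hom (shift (sval Y)) (sval K)))).
by rewrite (sod.1 _ _ (svalP (shift Y)) (sub_unshift BQ) v) compm0.
Qed.

(** Truncate K to Y[1] -> K -> X.  The [C]-part L of Y[1] is connective in degrees
    below 0, so it maps to zero in K, hence L -> Y[1] factors through X[-1] and is
    zero.  Then L = 0 and Y[1] is in [B], so that K is the [C]-part of X. *)
Lemma coconn_lift (K : subcat C) : coconn u K ->
  exists X Y, [/\ coconn t X, cpart X (incl C K), conn t Y
                & exact3 (incl C K) X (shift (shift Y))].
Proof.
move=> Ku; have [Y [X [Yt Xt e]]] := t_trunc_lt0 (incl C K) ts.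
exists X, Y; split=> //; last exact: exact3_rot.
exists (shift (shift Y)); split; [exact: svalP| |exact: exact3_rot].
have [y [x t1]] := e.
have [L cL] := cpart_exists Y; have Lt := stab cL Yt.
have [Q [CL BQ [l [q t2]]]] := cpart_shift cL.
apply/sub_shift/(sub_ext (tri_exact3 t2)) => //.
apply/sub_zero/zero_object_id.
have [h1 t3] := tri_unrot t1; have [h2 t4] := tri_unrot t2.
have l0 : l = 0.
  have [|v ->] := tri_lift (u := l) t3.
    have [_ [CL' _ _]] := cL.
    exact: (Ku (exist _ L CL') Lt (y \o l)).
  have /hom0_shift v0 := t_orth ts (conn_shift ts Lt) Xt.
  by rewrite (v0 v) compm0.
have [|v ->] := tri_lift (u := idm _) t4; first by rewrite l0 comp0m.
by rewrite (sod.1 _ _ CL (sub_unshift BQ) v) compm0.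
Qed.

(** The shift of [coconn_lift]; the last clause gives a bounded lift of a bounded
    object. *)
Lemma tplus_lift (K : subcat C) : tplus u K ->
  exists X, [/\ tplus t X, cpart X (incl C K)
              & tminus t (incl C K) -> tminus t X].
Proof.
move=> /(tplusE _ us)[n Kn].
have [X [Y [Xt cX Yt e]]] := coconn_lift Kn.
have KE : incl C (iter n unshift K) = iter n unshift (incl C K).
  exact: sval_iter_unshift.
rewrite KE in cX e.
exists (iter n shift X); split.
- apply/(tplusE _ ts); exists n; apply: (coconn_iso ts) Xt.
  exact: isomorphic_sym (isomorphic_iter_shiftK n X).
- apply: cpart_iso (cpart_iter_shift n cX); first exact: isomorphic_refl.
  exact: isomorphic_iter_unshiftK.
move=> /(tminusE _ ts)[m Kt]; apply/(tminusE _ ts); exists (m + n)%N.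
rewrite -iterD; apply: (conn_iter ts (m := (m + n)%N)).
  by rewrite leq_addr.
have em : exact3 (iter (m + n) shift (iter n unshift (incl C K)))
    (iter (m + n) shift X) (iter (m + n) shift (shift (shift Y))).
  by elim: (m + n)%N => //= k; apply: exact3_shift.
apply: (conn_ext ts em).
  apply: (conn_iso ts) Kt; rewrite iterD; apply: isomorphic_iter.
  exact: isomorphic_sym (isomorphic_iter_unshiftK n _).
by apply: (conn_iter ts (leq0n _)); do 2!apply: (conn_shift ts).
Qed.

Lemma cpart_tplus X (K : subcat C) :
  cpart X (incl C K) -> tplus t X -> tplus u K.
Proof.
move=> c /(tplusE _ ts)[n Xt]; apply/(tplusE _ us); exists n.
apply: cpart_coconn Xt; rewrite /= sval_iter_unshift.
exact: cpart_iter_unshift.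
Qed.

Lemma cpart_tminus X (K : subcat C) :
  cpart X (incl C K) -> tminus t X -> tminus u K.
Proof.
move=> c /(tminusE _ ts)[n Xt]; apply/(tminusE _ us); exists n.
by rewrite /= sval_iter_shift; apply: stab (cpart_iter_shift n c) Xt.
Qed.

Lemma tminus_induced (K : subcat C) : tminus u K -> tminus t (incl C K).
Proof.
move=> /(tminusE _ us)[n Kt]; apply/(tminusE _ ts); exists n.
by rewrite /= sval_iter_shift in Kt.
Qed.

Variables (gshriek : functor D (subcat C)) (adjg : adjunction (incl C) gshriek).

Lemma timage_gshriek : timage gshriek t = u.
Proof.
rewrite /timage !(ess_image_gshriek adjg); congr TPair; apply/seteqP; split=> K.
- by move=> [X Xt cX]; apply: stab cX Xt.
- by move=> Kt; exists (incl C K) => //; apply/cpart_refl/svalP.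
- by move=> [X Xt cX]; apply: cpart_coconn cX Xt.
- by move=> /coconn_lift[X [Y [Xt cX _ _]]]; exists X.
Qed.

Lemma heart_gshriek : heart u = ess_image gshriek (heart t).
Proof.
rewrite (ess_image_gshriek adjg); apply/seteqP; split=> K.
  move=> [Kt /coconn_lift[X [Y [Xt cX Yt e]]]]; exists X => //; split=> //.
  by apply: (conn_ext ts e) => //; do 2!apply: (conn_shift ts).
by move=> [X [Xt Xt'] cX]; split; [exact: stab cX Xt|exact: cpart_coconn cX Xt'].
Qed.

Lemma tplus_gshriek : tplus u = ess_image gshriek (tplus t).
Proof.
rewrite (ess_image_gshriek adjg); apply/seteqP; split=> K.
  by move=> /tplus_lift[X [Xt cX _]]; exists X.
by move=> [X Xt cX]; apply: cpart_tplus cX Xt.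
Qed.

Lemma tminus_gshriek : tminus u = ess_image gshriek (tminus t).
Proof.
rewrite (ess_image_gshriek adjg); apply/seteqP; split=> K.
  by move=> /tminus_induced Kt; exists (incl C K) => //; apply/cpart_refl/svalP.
by move=> [X Xt cX]; apply: cpart_tminus cX Xt.
Qed.

Lemma tbdd_gshriek : tbdd u = ess_image gshriek (tbdd t).
Proof.
rewrite (ess_image_gshriek adjg); apply/seteqP; split=> K.
  move=> [/tplus_lift[X [Xt cX Xm]] /tminus_induced Kt].
  by exists X => //; split=> //; apply: Xm.
by move=> [X [Xp Xm] cX]; split; [exact: cpart_tplus cX Xp|exact: cpart_tminus cX Xm].
Qed.

Lemma tbounded_induced : tbounded t -> tbounded u.
Proof.
rewrite /tbounded tbdd_gshriek (ess_image_gshriek adjg) => ->.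
by apply/seteqP; split=> // K _; exists (incl C K) => //; apply/cpart_refl/svalP.
Qed.

End Induced.

End Decomposition.

(** * Chain conditions in the heart *)

Section ChainCondition.
Variable D : triangulated.

(** The ascending chain condition for the subobjects K_n of X with cokernel Q_n in
    the heart.  Phrased with short exact sequences it makes sense without knowing
    that the heart is abelian, and its dual is the descending chain condition. *)
Definition heart_acc (t : tpair D) : Prop :=
  forall (X : D) (K Q : nat -> D)
    (i : forall n, hom (K n) X) (p : forall n, hom X (Q n)),
  heart t X -> (forall n, heart t (K n)) -> (forall n, heart t (Q n)) ->
  (forall n, tri (i n) (p n)) ->
  (forall n, exists v, i n.+1 \o v = i n) -> exists N v, i N \o v = i N.+1.

Lemma heart_mono (t : tpair D) (W K X Q : D) (i : hom K X) (p : hom X Q)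
    (u v : hom W K) : is_tstructure t -> tri i p -> conn t W -> coconn t Q ->
  i \o u = i \o v -> u = v.
Proof.
move=> ts ip Wt Qt uv; have [h hi] := tri_unrot ip.
have [|w /eqP] := tri_lift (u := u - v) hi; first by rewrite compmB uv subrr.
have /hom0_shift w0 := t_orth ts Wt Qt.
by rewrite (w0 w) compm0 subr_eq0 => /eqP.
Qed.

Lemma noetherian_heart_acc (t : tpair D) :
  is_tstructure t -> tnoetherian t -> heart_acc t.
Proof.
move=> ts noe X K Q i p Xt Kt Qt ip le.
pose H := full_subcat (heart t).
pose X' : H := exist _ X Xt; pose K' n : H := exist _ (K n) (Kt n).
have mono n : @is_mono H (K' n) X' (i n).
  by move=> W v w; apply: (heart_mono ts (ip n) (svalP W).1 (Qt n).2).
have [|N HN] := noe X' (fun n => Subobject (mono n)); first by move=> n; apply: le.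
by exists N; have [] := HN N.+1 (leqnSn N).
Qed.

End ChainCondition.

(** An ascending chain in the opposite heart is a chain of quotients Q_n of X with
    morphisms from Q_(n+1) to Q_n; the kernels K_n descend, and stabilization of the
    kernels is stabilization of the quotients. *)
Lemma artinian_heart_acc (D : triangulated) (t : tpair D) :
  is_tstructure t -> tartinian t -> heart_acc (opp_tpair t).
Proof.
move=> ts art X Q K p i [Xc Xt] Qt Kt ip le.
pose H := full_subcat (heart t).
pose X' : H := exist _ X (conj Xt Xc).
pose K' n : H := exist _ (K n) (conj (Kt n).2 (Kt n).1).
pose i' n : @hom D (K n) X := i n; pose p' n : @hom D X (Q n) := p n.
have tip n : tri (i' n) (p' n) by apply/opp_tri_tri; exact: ip.
have le' n : exists v : @hom D (Q n.+1) (Q n), v \o p' n.+1 = p' n by exact: le.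
have mono n : @is_mono H (K' n) X' (i' n).
  by move=> W v w; apply: (heart_mono ts (tip n) (svalP W).1 (Qt n).1).
have [n|N HN] := art X' (fun n => Subobject (mono n)).
  have [v vE] := le' n.
  have [|w wE] := tri_lift (u := i' n.+1) (tip n); last by exists w.
  by rewrite -vE -mcompA (tri_comp (tip n.+1)) compm0.
exists N; have [_ [w /= wE]] := HN N.+1 (leqnSn N).
suff [v vE] : exists v : @hom D (Q N) (Q N.+1), v \o p' N = p' N.+1 by exists v.
have [|v vE] := tri_desc (u := p' N.+1) (tip N); last by exists v.
by rewrite -wE mcompA (tri_comp (tip N.+1)) comp0m.
Qed.

(** * Tilting at a torsion class of a noetherian heart *)

(** [U] stands for the objects of the connective part whose H^0 lies in a given
    class of objects of the heart closed under quotients and extensions.  Closure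
    under quotients is encoded by [shift_conn_U] and [U_ext]: a quotient of V is an
    extension of V by the shift of the kernel. *)
Section Tilting.
Variables (D : triangulated) (t : tpair D).
Hypothesis ts : is_tstructure t.
Hypothesis acc : heart_acc t.
Variable U : set D.
Hypothesis U_conn : U `<=` conn t.
Hypothesis shift_conn_U : forall X, conn t X -> U (shift X).
Hypothesis U_ext : forall X Y Z, exact3 X Y Z -> U X -> U Z -> U Y.
Implicit Types X Y Z A S Q : D.

Record torsion_sub A : Type := TorsionSub {
  ts_obj : D;
  ts_quo : D;
  ts_map : hom ts_obj A;
  ts_proj : hom A ts_quo;
  ts_U : U ts_obj;
  ts_heart : heart t ts_obj;
  ts_quo_heart : heart t ts_quo;
  ts_tri : tri ts_map ts_proj }.

Definition ts_le A (S T : torsion_sub A) : Prop :=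
  exists v, ts_map T \o v = ts_map S.

(** Otherwise dependent choice, started at the zero subobject, gives a strictly
    increasing chain. *)
Lemma maximal_torsion_sub A : heart t A ->
  exists S : torsion_sub A, forall T, ts_le S T -> ts_le T S.
Proof.
move=> At; apply: contrapT => noS.
have step (S : torsion_sub A) : exists T, ts_le S T /\ ~ ts_le T S.
  apply: contrapT => noT; apply: noS; exists S => T ST.
  by apply: contrapT => TS; apply: noT; exists T.
have [next nextP] := choice step.
have [[O O0] _] := tadditive D; have sO0 := shift_zero_object O0.
have tri0 : tri (0 : hom (shift O) A) (idm A).
  by exists 0; apply: dist_0id.
pose S0 := TorsionSub (shift_conn_U (conn_zero ts O0))
  (conj (conn_zero ts sO0) (coconn_zero ts sO0)) At tri0.
pose S n := iter n next S0.
have [] := @acc A (fun n => ts_obj (S n)) (fun n => ts_quo (S n))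
  (fun n => ts_map (S n)) (fun n => ts_proj (S n)) At.
- by move=> n; apply: ts_heart.
- by move=> n; apply: ts_quo_heart.
- by move=> n; apply: ts_tri.
- by move=> n; have [] := nextP (S n).
by move=> N; have [] := nextP (S N).
Qed.

(** Let f be a morphism from V in [U] to Q = A/S.  One may replace V by its H^0.  The
    image I of f is then in [U] as a quotient of V, and its preimage T in A is in [U]
    as an extension of I by S.  Maximality gives T = S, hence I = 0.  Images and
    preimages are obtained as fibres of the morphisms to the cokernel G = H^0 of the
    cone of f. *)
Lemma hom0_torsion_free A (S : torsion_sub A) :
  (forall T, ts_le S T -> ts_le T S) ->
  forall V, U V -> hom0 V (ts_quo S).
Proof.
case: S => S Q i p US St Qt t_ip Smax V UV f /=.
(* H is H^0 of V. *)
have [W [H [Wt Ht e]]] := t_trunc_lt0 V ts; have [w [h t_wh]] := e.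
have eH := exact3_rot e.
have UH : U H := U_ext eH UV (shift_conn_U (conn_shift ts Wt)).
have [f' ->] := tri_desc t_wh (t_orth ts Wt Qt.2 (f \o w)).
suff -> : f' = 0 by rewrite comp0m.
have [E [c t_fc]] := tri_cone f'.
have Ec : conn t E.
  by apply: (conn_ext ts (exact3_rot (tri_exact3 t_fc)));
    [exact: Qt.1|apply/(conn_shift ts)/U_conn].
have [L [G [Lt Gt [l [g t_lg]]]]] := t_trunc_lt0 E ts.
have Gc : conn t G.
  apply: (conn_ext ts (exact3_rot (tri_exact3 t_lg))) => //.
  by do 2!apply: (conn_shift ts).
(* I, the kernel of Q -> G, is the image of f'; a is the map onto it. *)
have [I [j t_j]] := tri_cocone (g \o c).
have [a [b [t_ab jE _]]] := tri_cooctahedron t_fc t_lg t_j.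
have UI : U I := U_ext (tri_exact3 t_ab) UH (shift_conn_U Lt).
(* T, the kernel of A -> G, is the preimage of I. *)
have [T [k t_k]] := tri_cocone ((g \o c) \o p).
have [a' [b' [t_ab' iE jb]]] := tri_cooctahedron t_ip t_j t_k.
have UT : U T := U_ext (tri_exact3 t_ab') US UI.
have It : coconn t I.
  apply: (coconn_ext ts (exact3_unrot (tri_exact3 t_j))) Qt.2.
  exact: coconn_unshift.
have Tt : coconn t T := coconn_ext ts (tri_exact3 t_ab') St.2 It.
have [|v vE] := Smax (TorsionSub UT (conj (U_conn UT) Tt) (conj Gc Gt) t_k).
  by exists a'.
rewrite /= in vE.
(* As T -> Q vanishes, I -> Q factors through S[1], which is orthogonal to Q. *)
have jb0 : j \o b' = 0 by rewrite jb -vE mcompA (tri_comp t_ip) comp0m.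
have [h' t_bh] := tri_rot t_ab'.
have [x jE'] := tri_desc t_bh jb0.
by rewrite -jE jE' (t_orth ts St.1 Qt.2 x) !comp0m.
Qed.

(** Truncate X in degrees at most 0 to X', then X' to A = H^0 X; the fibre Y of
    X' -> A -> A/S is the truncation of X, where S is a maximal subobject of A in
    [U]. *)
Lemma torsion_trunc X :
  exists Y Z, [/\ U Y, forall W, U W -> hom0 W Z & exact3 Y X Z].
Proof.
have [X' [Z1 [X't Z1t [x [z t_xz]]]]] := t_trunc X ts.
have [W [A [Wt At e]]] := t_trunc_lt0 X' ts.
have Ac : conn t A.
  by apply: (conn_ext ts (exact3_rot e)) => //; do 2!apply: (conn_shift ts).
have [w [a t_wa]] := e.
have [S /hom0_torsion_free SQ] := maximal_torsion_sub (conj Ac At).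
have t_ip := ts_tri S.
have [Y [y t_y]] := tri_cocone (ts_proj S \o a).
have [b1 [b2 [t_b _ _]]] := tri_cooctahedron t_wa t_ip t_y.
have UY : U Y := U_ext (tri_exact3 t_b) (shift_conn_U Wt) (ts_U S).
have [Z [z' t_z]] := tri_cone (x \o y).
have [c1 [c2 [t_c _ _]]] := tri_octahedron t_y t_xz t_z.
exists Y, Z; split=> //; last exact: tri_exact3 t_z.
move=> V UV; apply: (hom0_extr (tri_exact3 t_c)); first exact: SQ.
exact/hom0_shift2/(t_orth ts (U_conn UV)).
Qed.

End Tilting.

(** * The connective part of the new t-structure *)

Section Tilted.
Variables (D : triangulated) (B C : tri_sub D).
Hypothesis sod : orthogonal_decomposition B C.
Variable t : tpair D.
Hypothesis ts : is_tstructure t.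
Hypothesis restr : t_restricts t B.
Implicit Types X Y Z K Q : D.

(** Truncating Q inside [B] gives Q -> Z with Z in [B] in degrees at least 1.  X -> Z
    vanishes, so Q -> Z factors through K[1], which is orthogonal to [B].  Thus Q is a
    direct summand of its connective truncation. *)
Lemma conn_bpart K X Q : C K -> B Q -> exact3 K X Q -> conn t X -> conn t Q.
Proof.
move=> CK BQ [k [q t_kq]] Xt.
have [Y [Z [Yt Zt [y [z t_yz]]]]] := @t_trunc (subcat B) _ (exist _ Q BQ) restr.
have /hom0_shift2 XZ := t_orth ts Xt Zt.
have [h t_qh] := tri_rot t_kq.
have [v zE] := @tri_desc D _ _ _ _ _ _ (z : hom Q (sval Z)) t_qh (XZ _).
have z0 : (z : hom Q (sval Z)) = 0.
  by rewrite zE (sod.1 _ _ (sub_shift CK) (svalP Z) v) comp0m.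
have t_yz' : @tri D (sval Y) Q (sval Z) y z by [].
have [|s /esym sE] := tri_lift (u := idm Q) t_yz'; first by rewrite z0 comp0m.
exact: (@conn_retract D t ts Q (sval Y) s y sE Yt).
Qed.

Definition tilted_conn : set D :=
  [set X | conn t X /\ exists2 K, cpart B C X K & conn t K].

Lemma tilted_conn_iso X Y : isomorphic X Y -> tilted_conn X -> tilted_conn Y.
Proof.
move=> i [Xt [K cK Kt]]; split; first exact: (conn_iso ts i).
by exists K => //; apply: cpart_iso cK => //; apply: isomorphic_refl.
Qed.

Lemma tilted_conn_shift X : tilted_conn X -> tilted_conn (shift X).
Proof.
move=> [Xt [K cK Kt]]; split; first exact: (conn_shift ts).
by exists (shift K); [exact: cpart_shift|exact: (conn_shift ts)].
Qed.

(** The [C]-part K of X is an extension of X by Q[-1], and Q is connective. *)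
Lemma shift_conn_tilted X : conn t X -> tilted_conn (shift X).
Proof.
move=> Xt; split; first exact: (conn_shift ts).
have [K cK] := cpart_exists sod X; exists (shift K); first exact: cpart_shift.
have [Q [CK BQ e]] := cK.
by apply: (conn_ext ts (exact3_rot (exact3_rot e)));
  [exact: conn_bpart e Xt|exact: (conn_shift ts)].
Qed.

(** The [C]-part is exact: let M be the fibre of Y -> Z -> Q_Z, an extension of K_Z by
    X.  As K_Z is orthogonal to Q_X, X -> Q_X extends to M; the fibre N of M -> Q_X is
    an extension of K_Z by K_X, and the cone of N -> Y is an extension of Q_Z by Q_X.
    So N is the [C]-part of Y. *)
Lemma tilted_conn_ext X Y Z :
  exact3 X Y Z -> tilted_conn X -> tilted_conn Z -> tilted_conn Y.
Proof.
move=> e [Xt [KX [QX [CKX BQX [kX [qX tX]]]] KXt]].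
move=> [Zt [KZ [QZ [CKZ BQZ [kZ [qZ tZ]]]] KZt]].
split; first exact: conn_ext e Xt Zt.
have [x [z t_xz]] := e.
have [M [m t_m]] := tri_cocone (qZ \o z).
have [a [b [t_ab mE kE]]] := tri_cooctahedron t_xz tZ t_m.
have [h t_ha] := tri_unrot t_ab.
have [r qE] : exists r : hom M QX, qX = r \o a.
  apply: (tri_desc t_ha).
  exact: (sod.1 _ _ (sub_unshift CKZ) BQX).
have [N [n t_n]] := tri_cocone r.
rewrite qE in tX.
have [a' [b' [t_N _ _]]] := tri_cooctahedron t_ha t_n tX.
have eN : exact3 KX N KZ.
  apply: exact3_iso (exact3_rot (tri_exact3 t_N)); try exact: isomorphic_refl.
  exact: isomorphic_shift_unshift.
exists N; last exact: (conn_ext ts eN).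
have [Q [q t_q]] := tri_cone (m \o n).
have [c [d [t_cd _ _]]] := tri_octahedron t_n t_m t_q.
exists Q; split; [exact: sub_ext eN _ _|exact: sub_ext (tri_exact3 t_cd) _ _|].
exact: tri_exact3 t_q.
Qed.

End Tilted.

(** * The noetherian case *)

Section ConnectiveSide.
Variables (D : triangulated) (B C : tri_sub D).
Hypothesis sod : orthogonal_decomposition B C.
Variables (gshriek : functor D (subcat C)) (adjg : adjunction (incl C) gshriek).
Variable tau : tpair D.
Hypothesis htau : is_tstructure tau.
Hypothesis acc : heart_acc tau.
Hypothesis restr : t_restricts tau B.

Definition tilted : tpair D :=
  TPair (tilted_conn B C tau)
    [set X | forall W, tilted_conn B C tau W -> hom0 (shift W) X].

Lemma tilted_tstructure : is_tstructure tilted.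
Proof.
apply: aisle_tstructure.
- by move=> X Y; apply: tilted_conn_iso.
- by move=> X; apply: tilted_conn_shift.
- move=> X; apply: (torsion_trunc htau acc).
  + by move=> Y [].
  + by move=> Y; apply: shift_conn_tilted.
  + by move=> Y Z W; apply: tilted_conn_ext.
Qed.

Lemma tilted_connE : conn tilted =
  [set X | conn tau X /\ conn tau (incl C (gshriek X))].
Proof.
apply/seteqP; split=> X [Xt].
  move=> [K cK Kt]; split=> //.
  exact: (conn_iso htau (isomorphic_sym (cpart_gshriek sod adjg cK)) Kt).
have [K cK] := cpart_exists sod X; split=> //; exists K => //.
exact: (conn_iso htau (cpart_gshriek sod adjg cK)).
Qed.

Lemma tilted_conn_sub (K : D) : C K -> tilted_conn B C tau K <-> conn tau K.
Proof.
by move=> CK; split=> [[]//|Kt]; split=> //; exists K => //; apply: cpart_refl.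
Qed.

Lemma tilted_stable X K : cpart B C X K -> conn tilted X -> conn tilted K.
Proof.
move=> cK [Xt [K' cK' Kt]]; have [Q [CK _ _]] := cK.
exact/(tilted_conn_sub CK)/(conn_iso htau (cpart_uniq sod adjg cK' cK) Kt).
Qed.

(** [C] has the same connective objects for tau and for the new t-structure, and
    these determine the induced pair. *)
Lemma tilted_induced : tconn_induced tilted C = tconn_induced tau C.
Proof.
have E : incl C @^-1` conn tilted = incl C @^-1` conn tau.
  by apply/seteqP; split=> K /(tilted_conn_sub (svalP K)).
pose aisle (P : set (subcat C)) : tpair (subcat C) :=
  TPair P [set X | forall W, P W -> hom0 (shift W) X].
exact: (congr1 aisle E).
Qed.

(** The connective parts of tau and of the new t-structure agree up to one shift. *)
Lemma tilted_bounded : tbounded tau -> tbounded tilted.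
Proof.
move=> bdd; apply/seteqP; split=> // X _; have ts := tilted_tstructure.
have [Xp Xm] : tbdd tau X by rewrite bdd.
split.
  apply/(tplusE _ ts); have /(tplusE _ htau)[n Xn] := Xp; exists n.
  by move=> W [Wt _]; exact: t_orth htau Wt Xn.
apply/(tminusE _ ts); have /(tminusE _ htau)[n Xn] := Xm; exists n.+1.
exact: (shift_conn_tilted sod htau restr Xn).
Qed.

Theorem connective_side :
  connectively_induces tau C /\
  exists tg : tpair D,
    (is_tstructure tg /\
     conn tg = [set X | conn tau X /\ conn tau (incl C (gshriek X))] /\
     t_projects gshriek tg /\
     timage gshriek tg = tconn_induced tau C) /\
    (heart (tconn_induced tau C) = ess_image gshriek (heart tg) /\
     tplus (tconn_induced tau C) = ess_image gshriek (tplus tg) /\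
     tminus (tconn_induced tau C) = ess_image gshriek (tminus tg) /\
     tbdd (tconn_induced tau C) = ess_image gshriek (tbdd tg)) /\
    t_exact gshriek tg (tconn_induced tau C) /\
    right_t_exact (incl C) (tconn_induced tau C) tg /\
    (tbounded tau -> tbounded tg /\ tbounded (tconn_induced tau C)).
Proof.
have ts := tilted_tstructure; have stab := tilted_stable.
have us := stable_connectively_induces sod ts stab.
have im := timage_gshriek sod ts stab adjg.
rewrite /connectively_induces -tilted_induced; split=> //; exists tilted.
split; first by rewrite /t_projects im -tilted_connE.
split.
  split; first exact: (heart_gshriek sod ts stab adjg).
  split; first exact: (tplus_gshriek sod ts stab adjg).
  split; first exact: (tminus_gshriek sod ts stab adjg).
  exact: (tbdd_gshriek sod ts stab adjg).
split; first by rewrite -im; split=> X Xt; exists X => //; apply: isomorphic_refl.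
split; first by [].
move=> /tilted_bounded bdd; split=> //.
exact: (tbounded_induced sod ts stab adjg bdd).
Qed.

End ConnectiveSide.

(** * The artinian case by duality *)

Section OppositeSubcategory.
Variables (D : triangulated) (A : tri_sub D).

Lemma opp_sub_iso (X Y : opp_tri D) : isomorphic X Y -> A X -> A Y.
Proof. by rewrite opp_isomorphic; apply: sub_iso. Qed.

Lemma opp_sub_zero (Z : opp_tri D) : zero_object Z -> A Z.
Proof. by move=> [Z1 Z2]; apply: sub_zero. Qed.

Lemma opp_sub_biproduct (X Y S : opp_tri D) : is_biproduct X Y S -> A X -> A Y -> A S.
Proof.
move=> [i [j [p [q [pi qj pj qi s]]]]]; apply: sub_biproduct.
by exists p, q, i, j.
Qed.

Lemma opp_sub_cone (X Y Z : opp_tri D) (f : hom X Y) (g : hom Y Z)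
  (h : hom Z (shift X)) : dist f g h -> A X -> A Y -> A Z.
Proof.
move=> d AX AY.
have /opp_exact3/exact3_unrot e : @exact3 (opp_tri D) X Y Z by exists f, g, h.
exact: sub_ext e (sub_unshift AX) AY.
Qed.

Definition opp_sub : tri_sub (opp_tri D) :=
  @TriSub (opp_tri D) A opp_sub_iso opp_sub_zero opp_sub_biproduct
    (@sub_unshift D A) (@sub_shift D A) opp_sub_cone.

(** The opposite of a subcategory and the subcategory of the opposite have
    convertible data and differ only in proofs. *)
Lemma opp_subcat_tstructure (t : tpair (subcat A)) :
  @is_tstructure (opp_tri (subcat A)) (opp_tpair t) <->
  @is_tstructure (subcat opp_sub) (@TPair (subcat opp_sub) (coconn t) (conn t)).
Proof. by split; case=> *; split. Qed.

Variable F : functor D (subcat A).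

Definition opp_reflector : functor (opp_tri D) (subcat opp_sub) :=
  @Functor (opp_tri D) (subcat opp_sub) (fun X => F X) (fun X Y f => fmap F f)
    (fun X => fmap1 F X) (fun X Y Z g f => fmapM F f g).

Lemma opp_ess_image (P : set D) :
  ess_image opp_reflector P = ess_image F P.
Proof.
by apply/seteqP; split=> Y [X PX [f [g [gf fg]]]]; exists X => //; exists g, f.
Qed.

Variable adjF : adjunction F (incl A).

Definition opp_adjunction : adjunction (incl opp_sub) opp_reflector :=
  @Adjunction (subcat opp_sub) (opp_tri D) (incl opp_sub) opp_reflector
    (fun X => acounit adjF X) (fun Y => aunit adjF Y)
    (fun X Y f => acounit_nat adjF f) (fun X Y f => aunit_nat adjF f)
    (adj_triangleG adjF) (adj_triangleF adjF).

End OppositeSubcategory.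

Lemma opp_tplus (D : triangulated) (t : tpair (opp_tri D)) :
  is_tstructure t -> tplus t = tminus (unopp_tpair t).
Proof.
move=> ts; apply/seteqP; split=> X.
  by move=> /(tplusE _ ts) ?; apply/(tminusE _ (unopp_tstructure ts)).
by move=> /(tminusE _ (unopp_tstructure ts)) ?; apply/(tplusE _ ts).
Qed.

Lemma opp_tminus (D : triangulated) (t : tpair (opp_tri D)) :
  is_tstructure t -> tminus t = tplus (unopp_tpair t).
Proof.
move=> ts; apply/seteqP; split=> X.
  by move=> /(tminusE _ ts) ?; apply/(tplusE _ (unopp_tstructure ts)).
by move=> /(tplusE _ (unopp_tstructure ts)) ?; apply/(tminusE _ ts).
Qed.

Lemma opp_tbdd (D : triangulated) (t : tpair (opp_tri D)) :
  is_tstructure t -> tbdd t = tbdd (unopp_tpair t).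
Proof. by move=> ts; rewrite /tbdd opp_tplus // opp_tminus // setIC. Qed.

Lemma opp_decomposition (D : triangulated) (B C : tri_sub D) :
  orthogonal_decomposition B C ->
  orthogonal_decomposition (opp_sub C) (opp_sub B).
Proof.
move=> [orth dec]; split=> [X Y BX CY|X]; first exact: (orth Y X CY BX).
have [K [Q [CK BQ e]]] := dec X.
by exists Q, K; split=> //; exact/opp_exact3.
Qed.

Section CoconnectiveSide.
Variables (D : triangulated) (B C : tri_sub D).
Hypothesis sod : orthogonal_decomposition B C.
Variables (bstar : functor D (subcat B)) (adjb : adjunction bstar (incl B)).
Variable tau : tpair D.
Hypothesis htau : is_tstructure tau.
Hypothesis art : tartinian tau.
Hypothesis restr : t_restricts tau C.

Theorem coconnective_side :
  coconnectively_induces tau B /\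
  exists tb : tpair D,
    (is_tstructure tb /\
     coconn tb = [set X | coconn tau X /\ coconn tau (incl B (bstar X))] /\
     t_projects bstar tb /\
     timage bstar tb = tcoconn_induced tau B) /\
    (heart (tcoconn_induced tau B) = ess_image bstar (heart tb) /\
     tplus (tcoconn_induced tau B) = ess_image bstar (tplus tb) /\
     tminus (tcoconn_induced tau B) = ess_image bstar (tminus tb) /\
     tbdd (tcoconn_induced tau B) = ess_image bstar (tbdd tb)) /\
    t_exact bstar tb (tcoconn_induced tau B) /\
    left_t_exact (incl B) (tcoconn_induced tau B) tb /\
    (tbounded tau -> tbounded tb /\ tbounded (tcoconn_induced tau B)).
Proof.
have orestr : t_restricts (opp_tpair tau) (opp_sub C).
  exact: (opp_subcat_tstructure _).1 (opp_tstructure restr).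
have [ous [tb [[ts [tbE [oproj im]]] [[hE [pE [mE bE]]] [[ex1 ex2] [rex bd]]]]]] :=
  connective_side (opp_decomposition sod) (opp_adjunction adjb)
    (opp_tstructure htau) (artinian_heart_acc htau art) orestr.
pose u := tcoconn_induced tau B.
have us' : @is_tstructure (opp_tri (subcat B)) (opp_tpair u).
  exact: (opp_subcat_tstructure u).2 ous.
have us : is_tstructure u := unopp_tstructure us'.
have tplus_u : tplus u = tminus (tconn_induced (opp_tpair tau) (opp_sub B)).
  exact: esym (opp_tminus us').
have tminus_u : tminus u = tplus (tconn_induced (opp_tpair tau) (opp_sub B)).
  exact: esym (opp_tplus us').
have tbs := unopp_tstructure ts.
have im' : timage bstar (unopp_tpair tb) = u.
  rewrite /timage -(opp_ess_image bstar (coconn tb)) -(opp_ess_image bstar (conn tb)).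
  exact: (congr1 (fun v : tpair (subcat (opp_sub B)) =>
    @TPair (subcat B) (coconn v) (conn v)) im).
split; first exact: us.
exists (unopp_tpair tb); split.
  split; first exact: tbs.
  split; first exact: tbE.
  by rewrite /t_projects im'; split.
split.
  split.
    by rewrite /heart -opp_ess_image setIC [X in ess_image _ X]setIC; exact: hE.
  split; first by rewrite tplus_u -(opp_tminus ts) -opp_ess_image; exact: mE.
  split; first by rewrite tminus_u -(opp_tplus ts) -opp_ess_image; exact: pE.
  rewrite /tbdd tplus_u tminus_u setIC -/(tbdd _) -/(tbdd (unopp_tpair tb)).
  by rewrite -(opp_tbdd ts) -opp_ess_image; exact: bE.
split; first by split; [exact: ex2|exact: ex1].
split; first exact: rex.
move=> bdd; have [tb_bdd u_bdd] := bd (etrans (opp_tbdd (opp_tstructure htau)) bdd).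
split; first by rewrite /tbounded -(opp_tbdd ts); exact: tb_bdd.
exact: etrans (esym (opp_tbdd us')) u_bdd.
Qed.

End CoconnectiveSide.

Theorem theorem5p7 (D : triangulated) (B C : tri_sub D)
    (sod : semiorthogonal B C)
    (bstar : functor D (subcat B)) (adjb : adjunction bstar (incl B))
    (gshriek : functor D (subcat C)) (adjg : adjunction (incl C) gshriek)
    (tau : tpair D) (htau : is_tstructure tau) :
  (tnoetherian tau -> t_restricts tau B ->
     connectively_induces tau C /\
     exists tg : tpair D,
       (is_tstructure tg /\
        conn tg = [set X | conn tau X /\ conn tau (incl C (gshriek X))] /\
        t_projects gshriek tg /\
        timage gshriek tg = tconn_induced tau C) /\
       (heart (tconn_induced tau C) = ess_image gshriek (heart tg) /\
        tplus (tconn_induced tau C) = ess_image gshriek (tplus tg) /\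
        tminus (tconn_induced tau C) = ess_image gshriek (tminus tg) /\
        tbdd (tconn_induced tau C) = ess_image gshriek (tbdd tg)) /\
       t_exact gshriek tg (tconn_induced tau C) /\
       right_t_exact (incl C) (tconn_induced tau C) tg /\
       (tbounded tau -> tbounded tg /\ tbounded (tconn_induced tau C))) /\
  (tartinian tau -> t_restricts tau C ->
     coconnectively_induces tau B /\
     exists tb : tpair D,
       (is_tstructure tb /\
        coconn tb = [set X | coconn tau X /\ coconn tau (incl B (bstar X))] /\
        t_projects bstar tb /\
        timage bstar tb = tcoconn_induced tau B) /\
       (heart (tcoconn_induced tau B) = ess_image bstar (heart tb) /\
        tplus (tcoconn_induced tau B) = ess_image bstar (tplus tb) /\
        tminus (tcoconn_induced tau B) = ess_image bstar (tminus tb) /\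
        tbdd (tcoconn_induced tau B) = ess_image bstar (tbdd tb)) /\
       t_exact bstar tb (tcoconn_induced tau B) /\
       left_t_exact (incl B) (tcoconn_induced tau B) tb /\
       (tbounded tau -> tbounded tb /\ tbounded (tcoconn_induced tau B))).
Proof.
move/semiorthogonal_decomposition in sod; split=> [noe|art] restr.
  exact: connective_side (noetherian_heart_acc htau noe) restr.
exact: (coconnective_side sod adjb htau art restr).
Qed.
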